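(* Let $G$ be a finite group. There is a canonical isomorphism of commutative graded rings \[\mathrm{Pow}(A(G))\cong\mathring{A}(G),\] namely the one carrying the universal family of power operations out of $A(G)$ to the family of total power operations $(\mathbb{P}_n\colon A(G)\to\mathring{A}(G,n))_{n\ge0}$.
   Context: For a finite group $\Gamma$, $A(\Gamma)$ is the Burnside ring, with canonical $\mathbb{Z}$-basis the isomorphism classes of transitive $\Gamma$-sets. $G\wr\Sigma_n=G^{\times n}\rtimes\Sigma_n$ acts on $X^{\times n}$, for a left $G$-set $X$, by $((\bar g,\sigma)x)_i=\bar g_ix_{\sigma^{-1}(i)}$. The transfer product $\star\colon A(G\wr\Sigma_i)\otimes A(G\wr\Sigma_j)\to A(G\wr\Sigma_{i+j})$ is $X\star Y=(G\wr\Sigma_{i+j})\times_{G\wr\Sigma_i\times G\wr\Sigma_j}(X\times Y)$; it makes $A(G\wr\Sigma)=\bigoplus_{n\ge0}A(G\wr\Sigma_n)$ a commutative $\mathbb{N}$-graded ring (commutative without signs). The total power operations $\mathbb{P}_n\colon A(G)\to A(G\wr\Sigma_n)$ are the unique functions with $\mathbb{P}_n([X])=[X^{\times n}]$, $\mathbb{P}_0=1$ and $\mathbb{P}_n(x+y)=\sum_{i+j=n}\mathbb{P}_i(x)\star\mathbb{P}_j(y)$. $\mathring{A}(G,n)\subseteq A(G\wr\Sigma_n)$ is the summand spanned by the smallest subset of the canonical basis whose span contains the image of $\mathbb{P}_n$; $\mathring{A}(G)=\bigoplus_{n\ge0}\mathring{A}(G,n)$ is a graded subring of $A(G\wr\Sigma)$.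 For an abelian group $A$ and a commutative graded ring $R=\bigoplus_{n\ge0}R_n$, an $R$-valued family of power operations on $A$ is a collection of functions $P_n\colon A\to R_n$, $n\ge0$, with $P_0(x)=1$ for all $x$, $P_n(0)=0$ for $n>0$, and $P_n(x+y)=\sum_{i+j=n}P_i(x)P_j(y)$ for all $x,y\in A$. $\mathrm{Pow}(A)$ is the commutative graded ring corepresenting $R\mapsto\{R\text{-valued families of power operations on }A\}$; explicitly it is generated by symbols $P_n(a)$ in degree $n$, for $a\in A$, $n\ge0$, subject to the relations $P_0(a)=1$, $P_n(0)=0$ for $n>0$, and $P_n(x+y)=\sum_{i+j=n}P_i(x)P_j(y)$. *)

(* Defs.v *)
From HB Require Import structures.
From mathcomp Require Import all_boot all_order all_fingroup all_algebra.
From mathcomp Require Import generic_quotient.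
From mathcomp Require Import boolp classical_sets.

Set Implicit Arguments.
Unset Strict Implicit.
Unset Printing Implicit Defensive.

Import GRing.Theory.

Local Open Scope ring_scope.
Local Open Scope quotient_scope.

(* Left actions, whereas fingroup.action has right actions. The group G of the
   theorem is the whole finGroupType gT *)
Record gset (gT : finGroupType) := GSet {
  gcar :> finType;
  lact : gT -> gcar -> gcar;
  lact1 : forall x, lact 1%g x = x;
  lactM : forall a b x, lact (a * b)%g x = lact a (lact b x) }.

Section GSets.
Variable gT : finGroupType.
Implicit Types X Y Z W : gset gT.

Definition equivariant X Y (f : X -> Y) := forall a x, f (lact a x) = lact a (f x).

Definition giso X Y : Prop := exists f : X -> Y, bijective f /\ equivariant f.

Definition gtransitive X : Prop :=
  (exists x : X, True) /\ forall x y : X, exists a, lact a x = y.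

Lemma lactK X a : cancel (@lact _ X a) (lact a^-1%g).
Proof. by move=> x; rewrite -lactM mulVg lact1. Qed.

Lemma lactVK X a : cancel (@lact _ X a^-1%g) (lact a).
Proof. by move=> x; rewrite -lactM mulgV lact1. Qed.

Lemma giso_refl X : giso X X.
Proof. by exists id; split=> //; exists id. Qed.

Lemma giso_sym X Y : giso X Y -> giso Y X.
Proof.
case=> f [[g fK gK] fE]; exists g; split; first by exists f.
by move=> a y; rewrite -{1}(gK y) -fE fK.
Qed.

Lemma giso_trans Y X Z : giso X Y -> giso Y Z -> giso X Z.
Proof.
case=> f [fb fE] [g [gb gE]]; exists (g \o f); split; first exact: bij_comp.
by move=> a x /=; rewrite fE gE.
Qed.

Lemma giso_inj_surj X Y (f : X -> Y) :
  injective f -> (forall y, exists x, f x = y) -> equivariant f -> giso X Y.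
Proof.
move=> fi fs fE; exists f; split=> //; exists (fun y => projT1 (cid (fs y))).
  by move=> x; apply: fi; case: cid.
by move=> y; case: cid.
Qed.

Definition gsum_act X Y (a : gT) (u : X + Y) : X + Y :=
  match u with inl x => inl (lact a x) | inr y => inr (lact a y) end.

Definition gsum X Y : gset gT.
Proof.
by exists (X + Y)%type (@gsum_act X Y) => [|a b] [x|y] /=; rewrite ?lact1 ?lactM.
Defined.

Definition gempty : gset gT.
Proof. by exists void (fun _ x => x). Defined.

Definition gpoint : gset gT.
Proof. by exists unit (fun _ x => x). Defined.

Definition gprod X Y : gset gT.
Proof.
exists (X * Y)%type (fun a u => (lact a u.1, lact a u.2)) => [|a b] [x y] /=.
  by rewrite !lact1.
by rewrite !lactM.
Defined.

Lemma gsum_iso X X' Y Y' : giso X X' -> giso Y Y' -> giso (gsum X Y) (gsum X' Y').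
Proof.
case=> f [[f' fK f'K] fE] [g [[g' gK g'K] gE]].
exists (fun u => match u with inl x => inl (f x) | inr y => inr (g y) end); split.
  exists (fun u => match u with inl x => inl (f' x) | inr y => inr (g' y) end).
    by case=> [x|y]; rewrite ?fK ?gK.
  by case=> [x|y]; rewrite ?f'K ?g'K.
by move=> a [x|y] /=; rewrite ?fE ?gE.
Qed.

Lemma gsumC X Y : giso (gsum X Y) (gsum Y X).
Proof.
exists (fun u => match u with inl x => inr x | inr y => inl y end); split.
  by exists (fun u => match u with inl x => inr x | inr y => inl y end); case.
by move=> a [x|y].
Qed.

Lemma gsumA X Y Z : giso (gsum X (gsum Y Z)) (gsum (gsum X Y) Z).
Proof.
exists (fun u => match u with
  inl x => inl (inl x) | inr (inl y) => inl (inr y) | inr (inr z) => inr z end).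
split; last by move=> a [x|[y|z]].
by exists (fun u => match u with
  inl (inl x) => inl x | inl (inr y) => inr (inl y) | inr z => inr (inr z) end);
  [case=> [|[]]|case=> [[]|]].
Qed.

Lemma gsum0 X : giso (gsum gempty X) X.
Proof.
apply: giso_sym; exists inr; split=> //.
by exists (fun u => match u with inl v => match v : void with end | inr x => x end); [|case].
Qed.

Lemma gprod_iso X X' Y Y' : giso X X' -> giso Y Y' -> giso (gprod X Y) (gprod X' Y').
Proof.
case=> f [[f' fK f'K] fE] [g [[g' gK g'K] gE]].
exists (fun u => (f u.1, g u.2)); split.
  by exists (fun u => (f' u.1, g' u.2)) => -[x y]; rewrite /= ?fK ?gK ?f'K ?g'K.
by move=> a [x y] /=; rewrite fE gE.
Qed.

Lemma gprodC X Y : giso (gprod X Y) (gprod Y X).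
Proof.
by exists (fun u => (u.2, u.1)); split=> //; exists (fun u => (u.2, u.1)); case.
Qed.

Lemma gprodA X Y Z : giso (gprod X (gprod Y Z)) (gprod (gprod X Y) Z).
Proof.
exists (fun u => ((u.1, u.2.1), u.2.2)); split=> //.
by exists (fun u => (u.1.1, (u.1.2, u.2))); [case=> ? []|case=> [[]]].
Qed.

Lemma gprod1 X : giso (gprod gpoint X) X.
Proof. by exists snd; split=> //; exists (fun x => (tt, x)) => // -[[] x]. Qed.

Lemma gprodDl X Y Z : giso (gprod (gsum X Y) Z) (gsum (gprod X Z) (gprod Y Z)).
Proof.
exists (fun u => match u.1 with inl x => inl (x, u.2) | inr y => inr (y, u.2) end).
split; last by move=> a [[x|y] z].
by exists (fun u => match u with
  inl p => (inl p.1, p.2) | inr p => (inr p.1, p.2) end); [case=> [[]]|case=> [[]|[]]].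
Qed.

End GSets.

(* A type of all gsets would be too large (universe-wise) to be quotiented to a
   choiceType, so isomorphism classes are taken among actions on the 'I_n; by
   small_of_gset_iso nothing is lost *)
Record small_gset (gT : finGroupType) := SmallGSet {
  scard : nat;
  sact : gT -> 'I_scard -> 'I_scard;
  sact1 : forall x, sact 1%g x = x;
  sactM : forall a b x, sact (a * b)%g x = sact a (sact b x) }.

Coercion gset_of_small gT (X : small_gset gT) : gset gT :=
  GSet (@sact1 _ X) (@sactM _ X).

Definition small_of_gset gT (X : gset gT) : small_gset gT.
Proof.
exists #|X| (fun a i => enum_rank (lact a (enum_val i))) => [i|a b i].
  by rewrite lact1 enum_valK.
by rewrite lactM enum_rankK.
Defined.

Lemma small_of_gset_iso gT (X : gset gT) : giso (small_of_gset X) X.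
Proof.
exists enum_val; split; first exact: enum_val_bij.
by move=> a i; rewrite /= enum_rankK.
Qed.

HB.instance Definition _ gT := gen_eqMixin (small_gset gT).
HB.instance Definition _ gT := gen_choiceMixin (small_gset gT).

Section IsoClasses.
Variable gT : finGroupType.
Implicit Types X Y Z : gset gT.

Definition small_giso (X Y : small_gset gT) : bool := `[< giso X Y >].

Lemma small_giso_equiv : equiv_class_of small_giso.
Proof.
split=> [X|X Y|Y X Z]; first exact/asboolP/giso_refl.
  by apply/asboolP/asboolP; apply: giso_sym.
by move=> /asboolP XY /asboolP YZ; apply/asboolP; apply: giso_trans YZ.
Qed.

Canonical small_giso_rel := EquivRelPack small_giso_equiv.

Definition isoclass := {eq_quot small_giso_rel}.
HB.instance Definition _ := Choice.on isoclass.

(* [X] as an element of the monoid of isomorphism classes under disjoint union *)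
Definition cls X : isoclass := \pi_{eq_quot small_giso_rel} (small_of_gset X).

Definition rep (c : isoclass) : gset gT := repr c.

Lemma clsP X Y : cls X = cls Y <-> giso X Y.
Proof.
split=> [/eqmodP/asboolP|] XY.
  apply: giso_trans (small_of_gset_iso Y).
  by apply: giso_trans XY; apply/giso_sym/small_of_gset_iso.
apply/eqmodP/asboolP; apply: giso_trans (small_of_gset_iso _) _.
by apply: giso_trans XY _; apply/giso_sym/small_of_gset_iso.
Qed.

Lemma clsK c : cls (rep c) = c.
Proof.
rewrite -[RHS]reprK; apply/eqmodP/asboolP; exact: small_of_gset_iso.
Qed.

Lemma repK X : giso (rep (cls X)) X.
Proof. by apply/clsP; rewrite clsK. Qed.

Definition cls_add (c d : isoclass) := cls (gsum (rep c) (rep d)).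
Definition cls_mul (c d : isoclass) := cls (gprod (rep c) (rep d)).

Lemma cls_addE X Y : cls_add (cls X) (cls Y) = cls (gsum X Y).
Proof. by apply/clsP/gsum_iso; apply: repK. Qed.

Lemma cls_mulE X Y : cls_mul (cls X) (cls Y) = cls (gprod X Y).
Proof. by apply/clsP/gprod_iso; apply: repK. Qed.

Lemma cls_addC : commutative cls_add.
Proof. by move=> c d; apply/clsP/gsumC. Qed.

Lemma cls_addA : associative cls_add.
Proof.
move=> c d e; rewrite -(clsK c) -(clsK d) -(clsK e) !cls_addE.
exact/clsP/gsumA.
Qed.

Lemma cls_add0 : left_id (cls (gempty gT)) cls_add.
Proof. by move=> c; rewrite -(clsK c) cls_addE; apply/clsP/gsum0. Qed.

HB.instance Definition _ :=
  GRing.isNmodule.Build isoclass cls_addA cls_addC cls_add0.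

Lemma clsD X Y : cls (gsum X Y) = cls X + cls Y.
Proof. by rewrite -cls_addE. Qed.

Lemma cls0 : cls (gempty gT) = 0.
Proof. by []. Qed.

Lemma cls_mulC : commutative cls_mul.
Proof. by move=> c d; apply/clsP/gprodC. Qed.

Lemma cls_mulA : associative cls_mul.
Proof.
move=> c d e; rewrite -(clsK c) -(clsK d) -(clsK e) !cls_mulE.
exact/clsP/gprodA.
Qed.

Lemma cls_mul1 : left_id (cls (gpoint gT)) cls_mul.
Proof. by move=> c; rewrite -(clsK c) cls_mulE; apply/clsP/gprod1. Qed.

Lemma cls_mulDl : left_distributive cls_mul +%R.
Proof.
move=> c d e; rewrite -(clsK c) -(clsK d) -(clsK e) -clsD !cls_mulE -clsD.
exact/clsP/gprodDl.
Qed.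

End IsoClasses.

Arguments cls {gT} X.

Section Grothendieck.
Variable M : nmodType.
Implicit Types (a b : M) (p q : M * M).

(* (a, b) stands for the formal difference a - b *)
Definition groth_eq p q : bool :=
  `[< exists k, p.1 + q.2 + k = q.1 + p.2 + k >].

Lemma groth_eq_equiv : equiv_class_of groth_eq.
Proof.
split=> [p|p q|q p r]; first by apply/asboolP; exists 0.
  by apply/asboolP/asboolP => -[k kE]; exists k.
move=> /asboolP[k kE] /asboolP[l lE]; apply/asboolP; exists (q.1 + q.2 + k + l).
rewrite [LHS](AC (2*4) ((1*4*5)*(3*2*6)))/=  kE lE.
by rewrite [RHS](AC (2*4) ((3*2*5)*(1*4*6)))/=.
Qed.

Canonical groth_rel := EquivRelPack groth_eq_equiv.

Definition groth := {eq_quot groth_rel}.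
HB.instance Definition _ := Choice.on groth.

Definition groth_pi p : groth := \pi_{eq_quot groth_rel} p.
Definition groth_rep (x : groth) : M * M := repr x.
Definition groth_add (x y : groth) : groth := groth_pi (groth_rep x + groth_rep y).
Definition groth_opp (x : groth) : groth :=
  groth_pi ((groth_rep x).2, (groth_rep x).1).

Lemma groth_piP p q :
  groth_pi p = groth_pi q <-> exists k, p.1 + q.2 + k = q.1 + p.2 + k.
Proof. by split=> [/eqmodP/asboolP|pq] //; apply/eqmodP/asboolP. Qed.

Lemma groth_repK x : groth_pi (groth_rep x) = x.
Proof. exact: reprK. Qed.

Lemma groth_addE p q : groth_add (groth_pi p) (groth_pi q) = groth_pi (p + q).
Proof.
apply/groth_piP => /=.
have /groth_piP[k kE] := groth_repK (groth_pi p).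
have /groth_piP[l lE] := groth_repK (groth_pi q).
exists (k + l); rewrite [LHS](AC (2*2*2) ((1*3*5)*(2*4*6)))/= kE lE.
by rewrite [RHS](AC (2*2*2) ((1*3*5)*(2*4*6)))/=.
Qed.

Lemma groth_oppE p : groth_opp (groth_pi p) = groth_pi (p.2, p.1).
Proof.
apply/groth_piP => /=.
have /groth_piP[k kE] := groth_repK (groth_pi p).
by exists k; rewrite [_ + p.1]addrC -kE; congr (_ + _); rewrite addrC.
Qed.

Lemma groth_ind (K : groth -> Prop) :
  (forall p, K (groth_pi p)) -> forall x, K x.
Proof. by move=> Kp x; rewrite -(groth_repK x). Qed.

Lemma groth_addA : associative groth_add.
Proof.
elim/groth_ind=> p; elim/groth_ind=> q; elim/groth_ind=> r.
by rewrite !groth_addE addrA.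
Qed.

Lemma groth_addC : commutative groth_add.
Proof. by move=> x y; rewrite /groth_add addrC. Qed.

Lemma groth_add0 : left_id (groth_pi 0) groth_add.
Proof. by elim/groth_ind=> p; rewrite groth_addE add0r. Qed.

Lemma groth_addN : left_inverse (groth_pi 0) groth_opp groth_add.
Proof.
elim/groth_ind=> p; rewrite groth_oppE groth_addE; apply/groth_piP; exists 0 => /=.
by rewrite !addr0 !add0r addrC.
Qed.

HB.instance Definition _ :=
  GRing.isZmodule.Build groth groth_addA groth_addC groth_add0 groth_addN.

Definition gin (a : M) : groth := groth_pi (a, 0).

Lemma gin0 : gin 0 = 0. Proof. by []. Qed.

Lemma ginD : {morph gin : a b / a + b}.
Proof. by move=> a b; rewrite /gin [RHS]groth_addE; congr groth_pi; congr pair; rewrite addr0. Qed.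

Lemma groth_piE p : groth_pi p = gin p.1 - gin p.2.
Proof.
rewrite [- _]groth_oppE [RHS]groth_addE; congr groth_pi.
by case: p => a b; congr pair; rewrite /= ?addr0 ?add0r.
Qed.

Lemma grothE x : x = gin (groth_rep x).1 - gin (groth_rep x).2.
Proof. by rewrite -groth_piE groth_repK. Qed.

Lemma groth_zind (K : groth -> Prop) :
  (forall a, K (gin a)) -> (forall x y, K x -> K y -> K (x - y)) ->
  forall x, K x.
Proof. by move=> Kin KB x; rewrite (grothE x); apply: KB. Qed.

End Grothendieck.

(* Additive extension of an additive f; locked to keep unification from
   unfolding it *)
HB.lock Definition groth_ext (M : nmodType) (Z : zmodType) (f : M -> Z)
    (x : groth M) : Z :=
  f (groth_rep x).1 - f (groth_rep x).2.

Section Ext.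
Variables (M : nmodType) (Z : zmodType) (f : M -> Z).
Hypothesis fD : {morph f : a b / a + b}.

Lemma groth_ext_pi p : groth_ext f (groth_pi p) = f p.1 - f p.2.
Proof.
have /groth_piP[k] := groth_repK (groth_pi p).
move/(congr1 f); rewrite !fD => /addIr E.
by rewrite groth_ext.unlock; apply/eqP; rewrite subr_eq addrAC -E addrK.
Qed.

Lemma groth_ext_in a : groth_ext f (gin a) = f a.
Proof.
rewrite groth_ext_pi /= [f 0](_ : _ = 0) ?subr0 //.
by apply: (addrI (f 0)); rewrite -fD !addr0.
Qed.

Lemma groth_extD : {morph groth_ext f : x y / x + y}.
Proof.
elim/groth_ind=> p; elim/groth_ind=> q.
by rewrite [_ + _]groth_addE !groth_ext_pi /= !fD opprD addrACA.
Qed.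
End Ext.

Lemma morphD0 (V W : zmodType) (f : V -> W) : {morph f : x y / x + y} -> f 0 = 0.
Proof. by move=> fD; apply: (addrI (f 0)); rewrite -fD !addr0. Qed.

Lemma morphDN (V W : zmodType) (f : V -> W) : {morph f : x y / x + y} -> {morph f : x / - x}.
Proof.
by move=> fD x; apply: (addrI (f x)); rewrite -fD !subrr (morphD0 fD).
Qed.

Lemma morphDB (V W : zmodType) (f : V -> W) :
  {morph f : x y / x + y} -> {morph f : x y / x - y}.
Proof. by move=> fD x y; rewrite fD (morphDN fD). Qed.

Definition groth_ext2 (M N : nmodType) (Z : zmodType) (f : M -> N -> Z)
    (x : groth M) (y : groth N) : Z :=
  groth_ext (fun a => groth_ext (f a) y) x.

Section Ext2.
Variables (M N : nmodType) (Z : zmodType) (f : M -> N -> Z).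
Hypothesis fDl : forall b, {morph f ^~ b : a a' / a + a'}.
Hypothesis fDr : forall a, {morph f a : b b' / b + b'}.

Lemma groth_ext2_aux y : {morph (fun a => groth_ext (f a) y) : a a' / a + a'}.
Proof.
move=> a a'; elim/groth_ind: y => p.
by rewrite !groth_ext_pi // !fDl opprD addrACA.
Qed.

Lemma groth_ext2_in a b : groth_ext2 f (gin a) (gin b) = f a b.
Proof.
by rewrite /groth_ext2 groth_ext_in ?groth_ext_in //; apply: groth_ext2_aux.
Qed.

Lemma groth_ext2Dl y : {morph groth_ext2 f ^~ y : x x' / x + x'}.
Proof. by apply: groth_extD; apply: groth_ext2_aux. Qed.

Lemma groth_ext2Dr x : {morph groth_ext2 f x : y y' / y + y'}.
Proof.
move=> y y'; elim/groth_ind: x => p; rewrite /groth_ext2.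
rewrite !(groth_ext_pi (groth_ext2_aux _)) /= !groth_extD //.
by rewrite opprD addrACA.
Qed.
End Ext2.

(* The Burnside ring: the Grothendieck group of finite gT-sets under disjoint
   union, with multiplication induced by the cartesian product (see bmulE) *)
Definition burnside (gT : finGroupType) := groth (isoclass gT).
HB.instance Definition _ gT := GRing.Zmodule.on (burnside gT).

Definition bcls (gT : finGroupType) (X : gset gT) : burnside gT := gin (cls X).

Section BurnsideRing.
Variable gT : finGroupType.
Implicit Types (X Y : gset gT) (x y : burnside gT).

Lemma bclsP_iso X Y : giso X Y -> bcls X = bcls Y.
Proof. by move=> XY; congr gin; apply/clsP. Qed.

Lemma bclsD X Y : bcls (gsum X Y) = bcls X + bcls Y.
Proof. by rewrite /bcls clsD; apply: ginD. Qed.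

Lemma bcls0 : bcls (gempty gT) = 0.
Proof. by []. Qed.

Lemma burnside_ind (K : burnside gT -> Prop) :
  (forall X, K (bcls X)) -> (forall x y, K x -> K y -> K (x - y)) ->
  forall x, K x.
Proof.
by move=> Kc KB; apply: groth_zind => // a; rewrite -(clsK a); apply: Kc.
Qed.

Definition bmul : burnside gT -> burnside gT -> burnside gT :=
  groth_ext2 (fun a b => gin (cls_mul a b)).

Let mulDl b : {morph (fun a => gin (@cls_mul gT a b)) : a a' / a + a'}.
Proof. by move=> a a'; rewrite cls_mulDl ginD. Qed.

Let mulDr a : {morph (fun b => gin (@cls_mul gT a b)) : b b' / b + b'}.
Proof. by move=> b b'; rewrite !(cls_mulC a) cls_mulDl ginD. Qed.

Lemma bmulE X Y : bmul (bcls X) (bcls Y) = bcls (gprod X Y).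
Proof. by rewrite /bmul groth_ext2_in // cls_mulE. Qed.

Lemma bmulDl : left_distributive bmul +%R.
Proof. by move=> x y z; exact: (groth_ext2Dl mulDl mulDr). Qed.

Lemma bmulDr : right_distributive bmul +%R.
Proof. by move=> x y z; exact: (groth_ext2Dr mulDl mulDr). Qed.

Let bmulBl z : {morph bmul ^~ z : x y / x - y}.
Proof. by apply: morphDB => x y; apply: bmulDl. Qed.

Let bmulBr z : {morph bmul z : x y / x - y}.
Proof. by apply: morphDB => x y; apply: bmulDr. Qed.

Lemma bmulC : commutative bmul.
Proof.
move=> x y; elim/burnside_ind: x => [X|x x' IH IH']; last first.
  by rewrite bmulBl bmulBr IH IH'.
elim/burnside_ind: y => [Y|y y' IH IH']; last by rewrite bmulBl bmulBr IH IH'.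
by rewrite !bmulE; apply/bclsP_iso/gprodC.
Qed.

Lemma bmulA : associative bmul.
Proof.
move=> x y z; elim/burnside_ind: x => [X|x x' IH IH']; last by rewrite !bmulBl IH IH'.
elim/burnside_ind: y => [Y|y y' IH IH']; last by rewrite bmulBl !bmulBr bmulBl IH IH'.
elim/burnside_ind: z => [Z|z z' IH IH']; last by rewrite !bmulBr IH IH'.
by rewrite !bmulE; apply/bclsP_iso/gprodA.
Qed.

Lemma bmul1 : left_id (bcls (gpoint gT)) bmul.
Proof.
elim/burnside_ind => [X|x x' IH IH']; last by rewrite bmulBr IH IH'.
by rewrite bmulE; apply/bclsP_iso/gprod1.
Qed.

HB.instance Definition _ := GRing.Zmodule_isComPzRing.Build (burnside gT)
  bmulA bmulC bmul1 bmulDl.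

End BurnsideRing.

(* gT x_hT Z: the quotient of gT * Z by (a * iota h, z) ~ (a, h z) *)
Section Induced.
Variables (hT gT : finGroupType) (iota : hT -> gT).
Hypothesis iotaM : {morph iota : x y / (x * y)%g}.

Let iota1 : iota 1%g = 1%g.
Proof. by apply: (mulgI (iota 1%g)); rewrite -iotaM !mulg1. Qed.

Let iotaV h : iota h^-1%g = (iota h)^-1%g.
Proof. by apply: (mulgI (iota h)); rewrite -iotaM !mulgV iota1. Qed.

Section Balanced.
Variable Z : gset hT.

Definition ind_eq (p q : gT * Z) : bool :=
  [exists h, (p.1 == q.1 * iota h)%g && (q.2 == lact h p.2)].

Lemma ind_eq_equiv : equiv_class_of ind_eq.
Proof.
have refl p : ind_eq p p.
  by apply/existsP; exists 1%g; rewrite iota1 mulg1 lact1 !eqxx.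
have sym p q : ind_eq p q -> ind_eq q p.
  case/existsP=> h /andP[/eqP E1 /eqP E2]; apply/existsP; exists h^-1%g.
  by rewrite E1 E2 iotaV mulgK lactK !eqxx.
split=> [//|p q|q p r]; first by apply/idP/idP; apply: sym.
case/existsP=> h /andP[/eqP E1 /eqP E2] /existsP[k /andP[/eqP E3 /eqP E4]].
by apply/existsP; exists (k * h)%g; rewrite E1 E3 E4 E2 iotaM mulgA lactM !eqxx.
Qed.

Canonical ind_rel := EquivRelPack ind_eq_equiv.

Definition ind_car := {eq_quot ind_rel}.
HB.instance Definition _ := Choice.on ind_car.
HB.instance Definition _ :=
  Countable.copy ind_car (can_type (@reprK _ {eq_quot ind_rel})).
Let ind_enumP : Finite.axiom (undup (map (\pi_{eq_quot ind_rel} : _ -> ind_car) (enum {: gT * Z}))).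
Proof.
move=> x; rewrite count_uniq_mem ?undup_uniq // mem_undup.
by apply/eqP; rewrite eqb1; apply/mapP; exists (repr x); rewrite ?mem_enum ?reprK.
Qed.
HB.instance Definition _ := isFinite.Build ind_car ind_enumP.

Definition ind_pi (p : gT * Z) : ind_car := \pi_{eq_quot ind_rel} p.

Definition ind_act (a : gT) (u : ind_car) : ind_car :=
  ind_pi (a * (repr u).1, (repr u).2)%g.

Lemma ind_piP p q :
  ind_pi p = ind_pi q <-> exists h, p.1 = (q.1 * iota h)%g /\ q.2 = lact h p.2.
Proof.
split=> [/eqmodP/existsP[h /andP[/eqP ? /eqP ?]]|[h [E1 E2]]]; first by exists h.
by apply/eqmodP/existsP; exists h; rewrite E1 E2 !eqxx.
Qed.

Lemma ind_actE a p : ind_act a (ind_pi p) = ind_pi (a * p.1, p.2)%g.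
Proof.
apply/ind_piP => /=; have /ind_piP[h [-> ->]] : ind_pi (repr (ind_pi p)) = ind_pi p.
  exact: reprK.
by exists h; rewrite mulgA.
Qed.

Lemma ind_piK u : ind_pi (repr u) = u. Proof. exact: reprK. Qed.

Definition induced : gset gT.
Proof.
exists ind_car ind_act => [u|a b u]; rewrite -(ind_piK u) !ind_actE.
  by rewrite mul1g -surjective_pairing.
by rewrite mulgA.
Defined.

End Balanced.

End Induced.

(* Internal description of an induced set: iota-equivariant f : Z -> W makes W
   a copy of gT x_hT Z *)
Definition is_induced (hT gT : finGroupType) (iota : hT -> gT)
    (Z : gset hT) (W : gset gT) (f : Z -> W) : Prop :=
  [/\ forall h z, f (lact h z) = lact (iota h) (f z),
      forall w, exists a z, w = lact a (f z) &
      forall a z z', lact a (f z) = f z' -> exists h, a = iota h /\ z' = lact h z].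

Lemma is_induced_kernel (hT gT : finGroupType) (iota : hT -> gT) (Z : gset hT) (W : gset gT)
    (f : Z -> W) : is_induced iota f -> forall a a' z z',
  lact a (f z) = lact a' (f z') <-> exists h, (a'^-1 * a = iota h)%g /\ z' = lact h z.
Proof.
case=> fE _ fk a a' z z'; split=> [E|[h [E ->]]].
  by apply: fk; rewrite lactM E lactK.
by rewrite fE -E -lactM mulgA mulgV mul1g.
Qed.

Lemma induced_is (hT gT : finGroupType) (iota : hT -> gT) (iotaM : {morph iota : x y / (x * y)%g})
    (Z : gset hT) :
  @is_induced _ _ iota Z (induced iotaM Z) (fun z => ind_pi iotaM (1%g, z)).
Proof.
split=> [h z|w|a z z'].
- rewrite /= ind_actE; apply/esym/ind_piP; exists h => /=.
  by rewrite mulg1 mul1g.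
- exists (repr w).1, (repr w).2.
  by rewrite /= ind_actE mulg1 -surjective_pairing ind_piK.
- by rewrite /= ind_actE => /ind_piP[h /= []]; rewrite mulg1 mul1g; exists h.
Qed.

Lemma is_induced_iso (hT hT' gT : finGroupType) (iota : hT -> gT) (iota' : hT' -> gT)
    (Z : gset hT) (Z' : gset hT') (W W' : gset gT) (f : Z -> W) (f' : Z' -> W')
    (v : hT -> hT') (u : Z -> Z') (c : gT) :
  is_induced iota f -> is_induced iota' f' ->
  bijective v -> bijective u -> (forall h z, u (lact h z) = lact (v h) (u z)) ->
  (forall h, iota' (v h) = c * iota h * c^-1)%g ->
  giso W W'.
Proof.
move=> fI f'I [v' vK v'K] [u' uK u'K] uE ccE.
have ker a a' z z' : lact a (f z) = lact a' (f z') <->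
    lact (a * c^-1)%g (f' (u z)) = lact (a' * c^-1)%g (f' (u z')).
  rewrite (is_induced_kernel fI) (is_induced_kernel f'I).
  rewrite invMg invgK -mulgA [((a'^-1) * (a * _))%g]mulgA mulgA.
  split=> -[h [E1 E2]].
    by exists (v h); rewrite ccE -E1 E2 uE mulgA.
  exists (v' h); split; last by rewrite -[z']uK E2 -{1}(v'K h) -uE uK.
  apply: (mulgI c); apply: (mulIg c^-1%g).
  by rewrite -ccE v'K -E1 mulgA.
have [fE fs fk] := fI; have [f'E f's f'k] := f'I.
have fs2 w : exists p : gT * Z, w = lact p.1 (f p.2).
  by have [a [z ->]] := fs w; exists (a, z).
pose s w := projT1 (cid (fs2 w)).
have sE w : w = lact (s w).1 (f (s w).2) by rewrite /s; case: cid.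
pose F (w : W) : W' := lact ((s w).1 * c^-1)%g (f' (u (s w).2)).
have FE a z : F (lact a (f z)) = lact (a * c^-1)%g (f' (u z)).
  by apply/ker; rewrite -sE.
apply: (@giso_inj_surj _ _ _ F).
- by move=> w w' /ker; rewrite -!sE.
- move=> w'; have [a [z ->]] := f's w'; exists (lact (a * c)%g (f (u' z))).
  by rewrite FE u'K mulgK.
- by move=> a w; rewrite [in LHS](sE w) -lactM FE /F -[in RHS]lactM mulgA.
Qed.

Lemma is_induced_comp (hT kT gT : finGroupType) (iota : hT -> kT) (iota' : kT -> gT)
    (Z : gset hT) (W : gset kT) (V : gset gT) (f : Z -> W) (g : W -> V) :
  is_induced iota f -> is_induced iota' g -> is_induced (iota' \o iota) (g \o f).
Proof.
move=> [fE fs fk] [gE gs gk]; split=> [h z|w|a z z'] /=.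
- by rewrite fE gE.
- have [a [w' ->]] := gs w; have [b [z ->]] := fs w'.
  by exists (a * iota' b)%g, z; rewrite lactM gE.
- case/gk=> k [-> E]; have [h [-> ->]] := fk _ _ _ (esym E).
  by exists h.
Qed.

(* External product, an (hT * kT)-set *)
Definition gxprod (hT kT : finGroupType) (X : gset hT) (Y : gset kT) :
  gset (hT * kT)%type.
Proof.
exists (X * Y)%type (fun a u => (lact a.1 u.1, lact a.2 u.2)).
  by case=> x y; rewrite /= !lact1.
by move=> a b [x y]; rewrite /= !lactM.
Defined.

Lemma is_induced_prod (hT hT' gT gT' : finGroupType) (iota : hT -> gT) (iota' : hT' -> gT')
    (Z : gset hT) (Z' : gset hT') (W : gset gT) (W' : gset gT')
    (f : Z -> W) (f' : Z' -> W') :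
  is_induced iota f -> is_induced iota' f' ->
  @is_induced _ _ (fun h : hT * hT' => (iota h.1, iota' h.2))
    (gxprod Z Z') (gxprod W W') (fun z => (f z.1, f' z.2)).
Proof.
move=> [fE fs fk] [f'E f's f'k]; split=> [h z|[w w']|a [z1 z1'] [z2 z2']] /=.
- by rewrite fE f'E.
- have [a [z ->]] := fs w; have [a' [z' ->]] := f's w'.
  by exists (a, a'), (z, z').
- case=> /fk[h [E1 ->]] /f'k[h' [E2 ->]]; exists (h, h').
  by rewrite -E1 -E2 -surjective_pairing.
Qed.

Lemma is_induced_id (gT : finGroupType) (Z : gset gT) : @is_induced _ _ id Z Z id.
Proof.
by split=> [//|w|a z z' <-]; [exists 1%g, w; rewrite lact1|exists a].
Qed.

Lemma is_induced_sum (hT gT : finGroupType) (iota : hT -> gT) (Z Z' : gset hT) (W W' : gset gT)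
    (f : Z -> W) (f' : Z' -> W') :
  is_induced iota f -> is_induced iota f' ->
  @is_induced _ _ iota (gsum Z Z') (gsum W W')
    (fun z => match z with inl z => inl (f z) | inr z => inr (f' z) end).
Proof.
move=> [fE fs fk] [f'E f's f'k]; split=> [h [z|z]|[w|w]|a [z|z] [z'|z']] //=.
- by rewrite fE.
- by rewrite f'E.
- by have [a [z ->]] := fs w; exists a, (inl z).
- by have [a [z ->]] := f's w; exists a, (inr z).
- by case=> /fk[h [-> ->]]; exists h.
- by case=> /f'k[h [-> ->]]; exists h.
Qed.

(* The wreath product of gT with 'S_n *)
Record wreath (gT : finGroupType) (n : nat) :=
  Wreath { wtup : {ffun 'I_n -> gT}; wperm : 'S_n }.

Section Wreath.
Variables (gT : finGroupType) (n : nat).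
Implicit Types a b c : wreath gT n.

Definition wpair a := (wtup a, wperm a).

Lemma wpairK : cancel wpair (fun p => Wreath p.1 p.2). Proof. by case. Qed.

HB.instance Definition _ := Finite.copy (wreath gT n) (can_type wpairK).

(* (g, s) (h, t) = (g . s(h), s after t) with s(h)_i = h_(s^-1 i). In 'S_n,
   t * s maps i to s (t i), so "s after t" is t * s *)
Definition wmul a b : wreath gT n :=
  Wreath [ffun i => wtup a i * wtup b ((wperm a)^-1 i)]%g (wperm b * wperm a)%g.
Definition wone : wreath gT n := Wreath [ffun => 1%g] 1%g.
Definition winv a : wreath gT n :=
  Wreath [ffun i => (wtup a (wperm a i))^-1]%g (wperm a)^-1%g.

Lemma wreathP a b : wtup a =1 wtup b -> wperm a =1 wperm b -> a = b.
Proof. by case: a b => [g s] [h t] /ffunP /= -> /permP /= ->. Qed.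

Lemma wmulA : associative wmul.
Proof.
move=> a b c; apply: wreathP => i /=; last by rewrite mulgA.
by rewrite !ffunE mulgA invMg permM.
Qed.

Lemma wmul1 : left_id wone wmul.
Proof.
move=> a; apply: wreathP => i /=; last by rewrite mulg1.
by rewrite !ffunE mul1g invg1 perm1.
Qed.

Lemma wmulV : left_inverse wone winv wmul.
Proof.
move=> a; apply: wreathP => i /=; last by rewrite mulgV.
by rewrite !ffunE invgK mulVg.
Qed.

HB.instance Definition _ := Finite_isGroup.Build (wreath gT n) wmulA wmul1 wmulV.

Lemma wtupM a b i : wtup (a * b)%g i = (wtup a i * wtup b ((wperm a)^-1%g i))%g.
Proof. by rewrite ffunE. Qed.

Lemma wpermM a b i : wperm (a * b)%g i = wperm a (wperm b i).
Proof. by rewrite permM. Qed.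

Variable X : gset gT.

Definition wact (a : wreath gT n) (x : {ffun 'I_n -> X}) : {ffun 'I_n -> X} :=
  [ffun i => lact (wtup a i) (x ((wperm a)^-1%g i))].

(* X^n with ((g, s) x)_i = g_i x_(s^-1 i) *)
Definition gpow : gset (wreath gT n).
Proof.
exists {ffun 'I_n -> X} wact => [x|a b x]; apply/ffunP=> i; rewrite !ffunE.
  by rewrite lact1 invg1 perm1.
by rewrite lactM invMg permM.
Defined.

End Wreath.

(* The block inclusion of (gT wr 'S_i) * (gT wr 'S_j) in gT wr 'S_n, for a given
   proof e of i + j = n *)
Section Blocks.
Variables (i j n : nat) (e : (i + j = n)%N).

Definition blk (u : 'I_i + 'I_j) : 'I_n := cast_ord e (unsplit u).
Definition unblk (k : 'I_n) : 'I_i + 'I_j := split (cast_ord (esym e) k).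

Lemma blkK : cancel blk unblk.
Proof. by move=> u; rewrite /unblk /blk cast_ordK unsplitK. Qed.

Lemma unblkK : cancel unblk blk.
Proof. by move=> k; rewrite /unblk /blk splitK cast_ordKV. Qed.

Definition bperm_fun (s : 'S_i) (t : 'S_j) (k : 'I_n) : 'I_n :=
  blk (match unblk k with inl a => inl (s a) | inr b => inr (t b) end).

Lemma bperm_inj s t : injective (bperm_fun s t).
Proof.
move=> k l /(can_inj blkK) E; rewrite -(unblkK k) -(unblkK l); move: E.
by case: (unblk k) (unblk l) => [a|a] [b|b] // [] /perm_inj ->.
Qed.

Definition bperm (s : 'S_i) (t : 'S_j) : 'S_n := perm (@bperm_inj s t).

Variable gT : finGroupType.

Definition wembed (p : wreath gT i * wreath gT j) : wreath gT n :=
  Wreath [ffun k => match unblk k with inl a => wtup p.1 a | inr b => wtup p.2 b end]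
         (bperm (wperm p.1) (wperm p.2)).

Lemma wembed_tup p u :
  wtup (wembed p) (blk u) = match u with inl a => wtup p.1 a | inr b => wtup p.2 b end.
Proof. by rewrite ffunE blkK. Qed.

Lemma wembed_perm p u : wperm (wembed p) (blk u) =
  blk (match u with inl a => inl (wperm p.1 a) | inr b => inr (wperm p.2 b) end).
Proof. by rewrite permE /bperm_fun blkK. Qed.

Lemma wembed_permV p u : (wperm (wembed p))^-1%g (blk u) =
  blk (match u with inl a => inl ((wperm p.1)^-1%g a)
                  | inr b => inr ((wperm p.2)^-1%g b) end).
Proof.
apply: (perm_inj (s := wperm (wembed p))); rewrite permKV wembed_perm.
by case: u => a; rewrite permKV.
Qed.

Lemma blkP (K : 'I_n -> Prop) : (forall u, K (blk u)) -> forall k, K k.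
Proof. by move=> Kb k; rewrite -(unblkK k). Qed.

Lemma wembedM : {morph wembed : p q / (p * q)%g}.
Proof.
move=> p q; apply: wreathP; apply: blkP => u.
  rewrite wtupM wembed_permV !wembed_tup.
  by case: u => a; rewrite wtupM.
by rewrite wpermM !wembed_perm; case: u => a; rewrite wpermM.
Qed.

(* Representative of the transfer product of [X] and [Y] *)
Definition transfer (X : gset (wreath gT i)) (Y : gset (wreath gT j)) :
  gset (wreath gT n) := induced wembedM (gxprod X Y).

End Blocks.

Section TransferTheory.
Variable gT : finGroupType.

Definition is_transfer i j n (e : (i + j = n)%N)
    (X : gset (wreath gT i)) (Y : gset (wreath gT j)) (W : gset (wreath gT n))
    (f : gxprod X Y -> W) := is_induced (@wembed _ _ _ e gT) f.

Lemma transfer_is i j n (e : (i + j = n)%N) (X : gset (wreath gT i))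
    (Y : gset (wreath gT j)) :
  exists f : gxprod X Y -> transfer e X Y, is_transfer e f.
Proof. by exists (fun z => ind_pi _ (1%g, z)); apply: induced_is. Qed.

Lemma transfer_isoP i j n (e : (i + j = n)%N) (X : gset (wreath gT i))
    (Y : gset (wreath gT j)) (W : gset (wreath gT n)) (f : gxprod X Y -> W) :
  is_transfer e f -> giso (transfer e X Y) W.
Proof.
move=> fI; have [g gI] := transfer_is e X Y.
apply: (is_induced_iso (v := id) (u := id) (c := 1%g) gI fI); try by exists id.
  by [].
by move=> h; rewrite invg1 mulg1 mul1g.
Qed.

Lemma transfer_iso i j n (e : (i + j = n)%N) (X X' : gset (wreath gT i))
    (Y Y' : gset (wreath gT j)) :
  giso X X' -> giso Y Y' -> giso (transfer e X Y) (transfer e X' Y').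
Proof.
move=> [f [[f' fK f'K] fE]] [g [[g' gK g'K] gE]].
have [s sI] := transfer_is e X Y; have [t tI] := transfer_is e X' Y'.
apply: (is_induced_iso (v := id) (u := (fun z => (f z.1, g z.2)) : gxprod X Y -> gxprod X' Y') (c := 1%g) sI tI).
- by exists id.
- by exists (fun z => (f' z.1, g' z.2)) => -[x y] /=; rewrite ?fK ?gK ?f'K ?g'K.
- by move=> h [x y] /=; rewrite fE gE.
- by move=> h; rewrite invg1 mulg1 mul1g.
Qed.

Lemma transferC i j n (e : (i + j = n)%N) (e' : (j + i = n)%N)
    (X : gset (wreath gT i)) (Y : gset (wreath gT j)) :
  giso (transfer e X Y) (transfer e' Y X).
Proof.
have [s sI] := transfer_is e X Y; have [t tI] := transfer_is e' Y X.
pose swp (A B : Type) (u : A + B) : B + A :=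
  match u with inl a => inr a | inr b => inl b end.
have swpK A B : cancel (@swp A B) (@swp B A) by case.
have c_inj : injective (fun k => blk e' (swp _ _ (unblk e k))).
  apply: can_inj (fun k => blk e (swp _ _ (unblk e' k))) _ => k.
  by rewrite blkK swpK unblkK.
pose c : wreath gT n := Wreath [ffun => 1%g] (perm c_inj).
have cE u : wperm c (blk e u) = blk e' (swp _ _ u) by rewrite permE blkK.
have cVE u : (wperm c)^-1%g (blk e' u) = blk e (swp _ _ u).
  by apply: (perm_inj (s := wperm c)); rewrite permKV cE swpK.
apply: (is_induced_iso (v := fun h => (h.2, h.1))
  (u := (fun z => (z.2, z.1)) : gxprod X Y -> gxprod Y X)
  (c := c) sI tI) => //.
- by exists (fun h => (h.2, h.1)); case.
- by exists (fun h => (h.2, h.1)); case.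
- move=> h; apply: (mulIg c); rewrite mulgKV; apply: wreathP.
    apply: (blkP (e := e')) => u.
    by rewrite !wtupM wembed_permV cVE !wembed_tup !ffunE mulg1 mul1g; case: u.
  apply: (blkP (e := e)) => u.
  by rewrite !wpermM wembed_perm !cE wembed_perm; case: u.
Qed.

Lemma transferA i j k ij jk n (e1 : (i + j = ij)%N) (e2 : (ij + k = n)%N)
    (e3 : (j + k = jk)%N) (e4 : (i + jk = n)%N)
    (X : gset (wreath gT i)) (Y : gset (wreath gT j)) (Z : gset (wreath gT k)) :
  giso (transfer e2 (transfer e1 X Y) Z) (transfer e4 X (transfer e3 Y Z)).
Proof.
have [f1 I1] := transfer_is e1 X Y.
have [f2 I2] := transfer_is e2 (transfer e1 X Y) Z.
have [f3 I3] := transfer_is e3 Y Z.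
have [f4 I4] := transfer_is e4 X (transfer e3 Y Z).
have J1 := is_induced_comp (is_induced_prod I1 (is_induced_id Z)) I2.
have J2 := is_induced_comp (is_induced_prod (is_induced_id X) I3) I4.
have b1 a : blk e2 (inl (blk e1 (inl a))) = blk e4 (inl a) by apply: val_inj.
have b2 a : blk e2 (inl (blk e1 (inr a))) = blk e4 (inr (blk e3 (inl a))).
  by apply: val_inj.
have b3 a : blk e2 (inr a) = blk e4 (inr (blk e3 (inr a))).
  by apply: val_inj; rewrite /= addnA e1.
apply: (is_induced_iso (v := fun h => (h.1.1, (h.1.2, h.2)))
  (u := (fun z => (z.1.1, (z.1.2, z.2))) :
    gxprod (gxprod X Y) Z -> gxprod X (gxprod Y Z)) (c := 1%g) J1 J2) => //.
- by exists (fun h => ((h.1, h.2.1), h.2.2)); [case=> [[]]|case=> ? []].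
- by exists (fun h => ((h.1, h.2.1), h.2.2)); [case=> [[]]|case=> ? []].
- move=> [[g h] l]; rewrite invg1 mulg1 mul1g /=; apply: wreathP.
    apply: (blkP (e := e2)) => -[|m]; last by rewrite b3 !wembed_tup -b3 wembed_tup.
    apply: (blkP (e := e1)) => -[] m; last first.
      by rewrite b2 !wembed_tup -b2 !wembed_tup.
    by rewrite b1 !wembed_tup -b1 !wembed_tup.
  apply: (blkP (e := e2)) => -[|m]; last by rewrite {1}b3 !wembed_perm -b3.
  apply: (blkP (e := e1)) => -[] m; last first.
    by rewrite {1}b2 !wembed_perm -b2.
  by rewrite {1}b1 !wembed_perm -b1.
Qed.

Lemma transferDl i j n (e : (i + j = n)%N) (X X' : gset (wreath gT i))
    (Y : gset (wreath gT j)) :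
  giso (transfer e (gsum X X') Y) (gsum (transfer e X Y) (transfer e X' Y)).
Proof.
have [f fI] := transfer_is e X Y; have [g gI] := transfer_is e X' Y.
have [s sI] := transfer_is e (gsum X X') Y.
apply: (is_induced_iso (v := id) (c := 1%g) sI (is_induced_sum fI gI)
  (u := (fun z => match z.1 with inl x => inl (x, z.2) | inr x => inr (x, z.2) end) :
    gxprod (gsum X X') Y -> gsum (gxprod X Y) (gxprod X' Y))).
- by exists id.
- by exists (fun u => match u with
    inl p => (inl p.1, p.2) | inr p => (inr p.1, p.2) end); [case=> [[]]|case=> [[]|[]]].
- by move=> h [[x|x] y].
- by move=> h; rewrite invg1 mulg1 mul1g.
Qed.

Lemma transfer1 n (e : (0 + n = n)%N) (X : gset (wreath gT n)) :
  giso (transfer e (gpoint (wreath gT 0)) X) X.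
Proof.
apply: (@transfer_isoP _ _ _ _ _ _ _ snd).
have eE p : wembed e p = p.2.
  have b a : blk e (inr a) = a by apply: val_inj.
  apply: wreathP; apply: (blkP (e := e)) => -[[]//|a].
    by rewrite wembed_tup b.
  by rewrite wembed_perm !b.
split=> [h z|x|a [[] x] [[] y] /= <-]; first by rewrite eE.
  by exists 1%g, (tt, x); rewrite lact1.
by exists (1%g, a); rewrite eE.
Qed.

(* The transfer product: biadditive, and [X] * [Y] = [transfer X Y] (starE) *)
Definition star i j n (e : (i + j = n)%N) :
    burnside (wreath gT i) -> burnside (wreath gT j) -> burnside (wreath gT n) :=
  groth_ext2 (fun c d => bcls (transfer e (rep c) (rep d))).

Section StarTheory.
Variables (i j n : nat) (e : (i + j = n)%N).

Let starf_in (X : gset (wreath gT i)) (Y : gset (wreath gT j)) :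
  bcls (transfer e (rep (cls X)) (rep (cls Y))) = bcls (transfer e X Y).
Proof. by apply/bclsP_iso/transfer_iso; apply: repK. Qed.

Let starfDl (d : isoclass (wreath gT j)) : {morph (fun c => bcls (transfer e (rep c) (rep d))) : c c' / c + c'}.
Proof.
move=> c c' /=; rewrite -bclsD -(bclsP_iso (transferDl _ _ _ _)).
apply/bclsP_iso/transfer_iso; last exact: giso_refl.
by rewrite -{1}(clsK c) -{1}(clsK c') -clsD; apply: repK.
Qed.

Let starfDr (c : isoclass (wreath gT i)) : {morph (fun d => bcls (transfer e (rep c) (rep d))) : d d' / d + d'}.
Proof.
move=> d d' /=; have e' : (j + i = n)%N by rewrite addnC.
rewrite !(bclsP_iso (transferC e e' _ _)) -bclsD -(bclsP_iso (transferDl _ _ _ _)).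
apply/bclsP_iso/transfer_iso; last exact: giso_refl.
by rewrite -{1}(clsK d) -{1}(clsK d') -clsD; apply: repK.
Qed.

Lemma starE (X : gset (wreath gT i)) (Y : gset (wreath gT j)) : star e (bcls X) (bcls Y) = bcls (transfer e X Y).
Proof. by rewrite /star groth_ext2_in. Qed.

Lemma starDl (y : burnside (wreath gT j)) : {morph star e ^~ y : x x' / x + x'}.
Proof. exact: (groth_ext2Dl starfDl starfDr). Qed.

Lemma starDr (x : burnside (wreath gT i)) : {morph star e x : y y' / y + y'}.
Proof. exact: (groth_ext2Dr starfDl starfDr). Qed.

Lemma starBl (y : burnside (wreath gT j)) : {morph star e ^~ y : x x' / x - x'}.
Proof. exact/morphDB/starDl. Qed.

Lemma starBr (x : burnside (wreath gT i)) : {morph star e x : y y' / y - y'}.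
Proof. exact/morphDB/starDr. Qed.
End StarTheory.

Lemma starC i j n (e : (i + j = n)%N) (e' : (j + i = n)%N)
    (x : burnside (wreath gT i)) (y : burnside (wreath gT j)) :
  star e x y = star e' y x.
Proof.
elim/burnside_ind: x => [X|x x' IH IH']; last by rewrite starBl starBr IH IH'.
elim/burnside_ind: y => [Y|y y' IH IH']; last by rewrite starBl starBr IH IH'.
by rewrite !starE; apply/bclsP_iso/transferC.
Qed.

Lemma starA i j k ij jk n (e1 : (i + j = ij)%N) (e2 : (ij + k = n)%N)
    (e3 : (j + k = jk)%N) (e4 : (i + jk = n)%N)
    (x : burnside (wreath gT i)) (y : burnside (wreath gT j))
    (z : burnside (wreath gT k)) :
  star e2 (star e1 x y) z = star e4 x (star e3 y z).
Proof.
elim/burnside_ind: x => [X|x x' IH IH']; last by rewrite !starBl IH IH'.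
elim/burnside_ind: y => [Y|y y' IH IH']; last by rewrite starBr !starBl starBr IH IH'.
elim/burnside_ind: z => [Z|z z' IH IH']; last by rewrite !starBr IH IH'.
by rewrite !starE; apply/bclsP_iso/transferA.
Qed.

Lemma star1 n (e : (0 + n = n)%N) (x : burnside (wreath gT n)) :
  star e (bcls (gpoint _)) x = x.
Proof.
elim/burnside_ind: x => [X|x x' IH IH']; last by rewrite !starBr IH IH'.
by rewrite starE; apply/bclsP_iso/transfer1.
Qed.

End TransferTheory.

(* Commutative N-graded rings (without signs), given by their homogeneous
   components. Indexing the product by a proof of i + j = n avoids transports *)
Record cgring := CGRing {
  gcomp :> nat -> zmodType;
  gone : gcomp 0;
  gmul : forall i j n, (i + j = n)%N -> gcomp i -> gcomp j -> gcomp n;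
  gmulDl : forall i j n (e : (i + j = n)%N) x x' y,
    gmul e (x + x') y = gmul e x y + gmul e x' y;
  gmulC : forall i j n (e : (i + j = n)%N) (e' : (j + i = n)%N) x y,
    gmul e x y = gmul e' y x;
  g1mul : forall n (e : (0 + n = n)%N) x, gmul e gone x = x;
  gmulA : forall i j k ij jk n (e1 : (i + j = ij)%N) (e2 : (ij + k = n)%N)
      (e3 : (j + k = jk)%N) (e4 : (i + jk = n)%N) x y z,
    gmul e2 (gmul e1 x y) z = gmul e4 x (gmul e3 y z) }.

(* The sum over n of A(gT wr 'S_n), under the transfer product *)
Definition burnside_wreath (gT : finGroupType) : cgring :=
  @CGRing (fun n => burnside (wreath gT n)) (bcls (gpoint _)) (@star gT)
    (fun i j n e x x' y => starDl e y x x') (@starC gT) (@star1 gT) (@starA gT).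

Section GradedTheory.
Variable R : cgring.

Lemma gmulDr i j n (e : (i + j = n)%N) (x : R i) (y y' : R j) :
  gmul e x (y + y') = gmul e x y + gmul e x y'.
Proof.
have e' : (j + i = n)%N by rewrite addnC.
by rewrite !(gmulC e e') gmulDl.
Qed.

Definition gconv (p q : forall n, R n) (n : nat) : R n :=
  \sum_(i < n.+1) gmul (subnKC (leq_ord i)) (p i) (q (n - i)%N).

(* gmul extended by 0 to degrees with i + j <> n, to reindex double sums *)
Definition gmulx n i j (x : R i) (y : R j) : R n :=
  match (i + j)%N =P n with ReflectT e => gmul e x y | ReflectF _ => 0 end.

Lemma gmulxE n i j (e : (i + j = n)%N) (x : R i) (y : R j) :
  gmulx n x y = gmul e x y.
Proof. by rewrite /gmulx; case: eqP => // e'; rewrite (eq_irrelevance e' e). Qed.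

Lemma gmulx_out n i j (x : R i) (y : R j) : (i + j)%N <> n -> gmulx n x y = 0.
Proof. by rewrite /gmulx; case: eqP. Qed.

Lemma gmulxDl n i j (y : R j) : {morph (fun x : R i => gmulx n x y) : x x' / x + x'}.
Proof. by move=> x x'; rewrite /gmulx; case: eqP => [e|_]; rewrite ?gmulDl ?addr0. Qed.

Lemma gmulxDr n i j (x : R i) : {morph (fun y : R j => gmulx n x y) : y y' / y + y'}.
Proof. by move=> y y'; rewrite /gmulx; case: eqP => [e|_]; rewrite ?gmulDr ?addr0. Qed.

Lemma gmulx0 n i j (x : R i) : gmulx n x (0 : R j) = 0.
Proof. exact: (morphD0 (@gmulxDr n i j x)). Qed.

Lemma gmul0x n i j (y : R j) : gmulx n (0 : R i) y = 0.
Proof. exact: (morphD0 (@gmulxDl n i j y)). Qed.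

Lemma gmulx_sumr n i j (x : R i) (I : Type) (s : seq I) (F : I -> R j) :
  gmulx n x (\sum_(k <- s) F k) = \sum_(k <- s) gmulx n x (F k).
Proof.
by elim: s => [|a s IH]; rewrite ?big_nil ?gmulx0 // !big_cons gmulxDr IH.
Qed.

Lemma gmulxC n i j (x : R i) (y : R j) : gmulx n x y = gmulx n y x.
Proof.
have [e|ne] := (i + j)%N =P n; last by rewrite !gmulx_out // addnC.
have e' : (j + i = n)%N by rewrite addnC.
by rewrite (gmulxE e) (gmulxE e') (gmulC e e').
Qed.

Lemma gmulx_inner n N i (x : R i) (q : forall n, R n) : (n < N)%N ->
  \sum_(j < N) gmulx n x (q j) = gmulx n x (q (n - i)%N).
Proof.
move=> nN; have lt : (n - i < N)%N by apply: leq_ltn_trans nN; apply: leq_subr.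
rewrite (bigD1 (Ordinal lt)) //= big1 ?addr0 // => j /eqP nj.
by apply: gmulx_out => E; apply: nj; apply: val_inj; rewrite /= -E addKn.
Qed.

Lemma gconvE N (p q : forall n, R n) n : (n < N)%N ->
  gconv p q n = \sum_(i < N) \sum_(j < N) gmulx n (p i) (q j).
Proof.
move=> nN; pose F i := gmulx n (p i) (q (n - i)%N).
rewrite (eq_bigr (fun i : 'I_N => F i)) => [|i _]; last exact: gmulx_inner.
transitivity (\sum_(i < n.+1) F i).
  by apply: eq_bigr => i _; rewrite /F (gmulxE (subnKC (leq_ord i))).
rewrite (big_ord_widen N F nN) big_mkcond; apply: eq_bigr => i _.
case: ifPn => //; rewrite ltnS -ltnNge => ni; rewrite /F gmulx_out // => E.
by rewrite -E ltnNge leq_addr in ni.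
Qed.

Lemma gconvC (p q : forall n, R n) n : gconv p q n = gconv q p n.
Proof.
rewrite !(gconvE _ _ (ltnSn n)) exchange_big; apply: eq_bigr => i _.
by apply: eq_bigr => j _; apply: gmulxC.
Qed.

Let tri n i j k (x : R i) (y : R j) (z : R k) := gmulx n x (gmulx (j + k) y z).

Lemma gconv3 (p q r : forall n, R n) n : gconv p (gconv q r) n =
  \sum_(i < n.+1) \sum_(j < n.+1) \sum_(k < n.+1) tri n (p i) (q j) (r k).
Proof.
rewrite (gconvE _ _ (ltnSn n)); apply: eq_bigr => i _.
transitivity (\sum_(m < n.+1) \sum_(j < n.+1) \sum_(k < n.+1)
    gmulx n (p i) (gmulx m (q j) (r k))).
  apply: eq_bigr => m _; rewrite (gconvE _ _ (ltn_ord m)) gmulx_sumr.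
  by apply: eq_bigr => j _; rewrite gmulx_sumr.
rewrite exchange_big; apply: eq_bigr => j _.
rewrite exchange_big; apply: eq_bigr => k _.
have [lt|ge] := ltnP (j + k) n.+1.
  rewrite (bigD1 (Ordinal lt)) //= big1 ?addr0 // => m /eqP nm.
  rewrite [gmulx m _ _]gmulx_out ?gmulx0 // => E.
  by apply: nm; apply: val_inj.
rewrite big1 => [|m _]; last first.
  rewrite [gmulx m _ _]gmulx_out ?gmulx0 // => E.
  by rewrite E leqNgt ltn_ord in ge.
rewrite /tri gmulx_out // => E.
by move: (leq_addl i (j + k)); rewrite E leqNgt ge.
Qed.

Lemma gconvA (p q r : forall n, R n) n :
  gconv p (gconv q r) n = gconv (gconv p q) r n.
Proof.
rewrite [RHS]gconvC !gconv3 [RHS]exchange_big; apply: eq_bigr => i _.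
rewrite [RHS]exchange_big; apply: eq_bigr => j _.
apply: eq_bigr => k _; rewrite /tri.
have [e|ne] := (i + (j + k))%N =P n; last first.
  by rewrite !gmulx_out // => E; apply: ne; rewrite addnA addnC.
have e' : (k + (i + j) = n)%N by rewrite addnC -addnA.
have e2 : ((i + j) + k = n)%N by rewrite -addnA.
rewrite (gmulxE e) (gmulxE e') !(gmulxE erefl) (gmulC e' e2).
exact/esym/gmulA.
Qed.

Definition gunit (n : nat) : R n := match n with 0 => gone R | _.+1 => 0 end.

Lemma gunit_conv (p : forall n, R n) n : gconv gunit p n = p n.
Proof.
rewrite /gconv big_ord_recl big1 => [|i _]; last first.
  by rewrite -gmulxE gmul0x.
rewrite addr0 /= -gmulxE.
have -> : gmulx n (gone R) (p (n - 0)%N) = gmulx n (gone R) (p n) by rewrite subn0.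
by rewrite (gmulxE (add0n n)) g1mul.
Qed.

Lemma gconv_ext (p p' q q' : forall n, R n) n :
  (forall i, (i <= n)%N -> p i = p' i) -> (forall i, (i <= n)%N -> q i = q' i) ->
  gconv p q n = gconv p' q' n.
Proof.
move=> pE qE; apply: eq_bigr => i _; rewrite pE -1?ltnS //.
by rewrite qE // leq_subr.
Qed.

Definition ginv_step (p q : forall n, R n) (n : nat) : R n :=
  gunit n - \sum_(i < n) gmulx n (p i.+1) (q (n - i.+1)%N).

Definition ginv (p : forall n, R n) (n : nat) : R n :=
  iter n.+1 (ginv_step p) (fun n => 0) n.

Lemma ginv_stable p N M n : (n < N)%N -> (n < M)%N ->
  iter N (ginv_step p) (fun n => 0) n = iter M (ginv_step p) (fun n => 0) n.
Proof.
elim/ltn_ind: n N M => n IH [//|N] [//|M] nN nM; rewrite !iterS /ginv_step.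
congr (_ - _); apply: eq_bigr => i _; congr gmulx.
have lt : (n - i.+1 < n)%N by rewrite ltn_subrL /=; apply: leq_trans (ltn_ord i).
by apply: IH => //; apply: leq_trans lt _.
Qed.

Lemma ginvE p n :
  ginv p n = gunit n - \sum_(i < n) gmulx n (p i.+1) (ginv p (n - i.+1)%N).
Proof.
rewrite {1}/ginv iterS {1}/ginv_step; congr (_ - _); apply: eq_bigr => i _.
have lt : (n - i.+1 < n)%N by rewrite ltn_subrL /=; apply: leq_trans (ltn_ord i).
by congr gmulx; apply: ginv_stable.
Qed.

Lemma ginvP (p : forall n, R n) : p 0%N = gone R ->
  forall n, gconv (ginv p) p n = gunit n.
Proof.
move=> p0 n; rewrite gconvC /gconv big_ord_recl /= -gmulxE p0.
have -> : gmulx n (gone R) (ginv p (n - 0)%N) = gmulx n (gone R) (ginv p n).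
  by rewrite subn0.
rewrite (gmulxE (add0n n)) g1mul ginvE.
rewrite (eq_bigr (fun i : 'I_n => gmulx n (p i.+1) (ginv p (n - i.+1)%N))).
  by rewrite subrK.
by move=> i _; rewrite -gmulxE.
Qed.

Lemma ginv0 p : ginv p 0%N = gone R.
Proof. by rewrite ginvE big_ord0 subr0. Qed.

Lemma gconv0 p q : p 0%N = gone R -> q 0%N = gone R -> gconv p q 0%N = gone R.
Proof.
by move=> p0 q0; rewrite /gconv big_ord1 /= -gmulxE p0 (gmulxE (add0n 0)) g1mul.
Qed.

Lemma gconv_unique (p q r : forall n, R n) : p 0%N = gone R ->
  (forall n, gconv p q n = gconv p r n) -> forall n, q n = r n.
Proof.
move=> p0 E n; rewrite -gunit_conv -[RHS]gunit_conv.
rewrite -(gconv_ext (p := gconv (ginv p) p) (q := q)) => // [|i _]; last exact: ginvP.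
rewrite -[in RHS](gconv_ext (p := gconv (ginv p) p) (q := r)) => // [|i _]; last exact: ginvP.
by rewrite -!gconvA; apply: gconv_ext.
Qed.

End GradedTheory.

(* Families (p_n) with p_0 = 1 form an abelian group under the Cauchy product;
   an R-valued power family on A is an additive map from A to it *)
Record gseries (R : cgring) := GSeries {
  gser : forall n, R n; gser0 : gser 0%N = gone R }.

HB.instance Definition _ R := gen_eqMixin (gseries R).
HB.instance Definition _ R := gen_choiceMixin (gseries R).

Section Series.
Variable R : cgring.
Implicit Types p q : gseries R.

Lemma gserP p q : (forall n, gser p n = gser q n) -> p = q.
Proof.
case: p q => p p0 [q q0] /= pq; have E : p = q by apply: functional_extensionality_dep.
by rewrite -E in q0 *; congr GSeries; apply: Prop_irrelevance.
Qed.

Definition gser_mul p q := GSeries (gconv0 (gser0 p) (gser0 q)).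
Definition gser_inv p := GSeries (ginv0 (gser p)).
Definition gser_one : gseries R := GSeries (erefl : gunit R 0 = gone R).

Lemma gser_mulA : associative gser_mul.
Proof. by move=> p q r; apply: gserP => n; apply: gconvA. Qed.
Lemma gser_mulC : commutative gser_mul.
Proof. by move=> p q; apply: gserP => n; apply: gconvC. Qed.
Lemma gser_mul1 : left_id gser_one gser_mul.
Proof. by move=> p; apply: gserP => n; apply: gunit_conv. Qed.
Lemma gser_mulV : left_inverse gser_one gser_inv gser_mul.
Proof. by move=> p; apply: gserP => n; apply: ginvP; apply: gser0. Qed.

HB.instance Definition _ :=
  GRing.isZmodule.Build (gseries R) gser_mulA gser_mulC gser_mul1 gser_mulV.

End Series.

Definition is_power_family (A : zmodType) (R : cgring) (P : forall n, A -> R n) :=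
  [/\ forall a, P 0%N a = gone R,
      forall n, (0 < n)%N -> P n 0 = 0 &
      forall n a b, P n (a + b) =
        \sum_(i < n.+1) gmul (subnKC (leq_ord i)) (P i a) (P (n - i)%N b)].

Definition gr_hom (R S : cgring) (f : forall n, R n -> S n) :=
  [/\ forall n, {morph f n : x y / x + y},
      f 0%N (gone R) = gone S &
      forall i j n (e : (i + j = n)%N) x y,
        f n (gmul e x y) = gmul e (f i x) (f j y)].

Definition gr_iso (R S : cgring) (f : forall n, R n -> S n) :=
  gr_hom f /\ forall n, bijective (f n).

Section Pow.
Variable A : zmodType.

(* Pow A by generators and relations: graded ring expressions in the symbols
   P_n(a), modulo the congruence generated by the axioms of commutative graded
   rings and the three relations pow_P0, pow_Pn0, pow_PD *)
Inductive pow_term : nat -> Type :=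
| pow_P n of A : pow_term n
| pow_0 n : pow_term n
| pow_1 : pow_term 0
| pow_add n of pow_term n & pow_term n : pow_term n
| pow_opp n of pow_term n : pow_term n
| pow_mul i j n of (i + j = n)%N & pow_term i & pow_term j : pow_term n.

Inductive pow_eq : forall n, pow_term n -> pow_term n -> Prop :=
| pow_eq_refl n (x : pow_term n) : pow_eq x x
| pow_eq_sym n (x y : pow_term n) : pow_eq x y -> pow_eq y x
| pow_eq_trans n (x y z : pow_term n) : pow_eq x y -> pow_eq y z -> pow_eq x z
| pow_eq_add n (x x' y y' : pow_term n) :
    pow_eq x x' -> pow_eq y y' -> pow_eq (pow_add x y) (pow_add x' y')
| pow_eq_opp n (x x' : pow_term n) : pow_eq x x' -> pow_eq (pow_opp x) (pow_opp x')
| pow_eq_mul i j n (e : (i + j = n)%N) (x x' : pow_term i) (y y' : pow_term j) :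
    pow_eq x x' -> pow_eq y y' -> pow_eq (pow_mul e x y) (pow_mul e x' y')
| pow_addA n (x y z : pow_term n) :
    pow_eq (pow_add x (pow_add y z)) (pow_add (pow_add x y) z)
| pow_addC n (x y : pow_term n) : pow_eq (pow_add x y) (pow_add y x)
| pow_add0 n (x : pow_term n) : pow_eq (pow_add (pow_0 n) x) x
| pow_addN n (x : pow_term n) : pow_eq (pow_add (pow_opp x) x) (pow_0 n)
| pow_mulDl i j n (e : (i + j = n)%N) (x x' : pow_term i) (y : pow_term j) :
    pow_eq (pow_mul e (pow_add x x') y) (pow_add (pow_mul e x y) (pow_mul e x' y))
| pow_mulC i j n (e : (i + j = n)%N) (e' : (j + i = n)%N)
    (x : pow_term i) (y : pow_term j) : pow_eq (pow_mul e x y) (pow_mul e' y x)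
| pow_mul1 n (e : (0 + n = n)%N) (x : pow_term n) : pow_eq (pow_mul e pow_1 x) x
| pow_mulA i j k ij jk n (e1 : (i + j = ij)%N) (e2 : (ij + k = n)%N)
    (e3 : (j + k = jk)%N) (e4 : (i + jk = n)%N)
    (x : pow_term i) (y : pow_term j) (z : pow_term k) :
    pow_eq (pow_mul e2 (pow_mul e1 x y) z) (pow_mul e4 x (pow_mul e3 y z))
| pow_P0 a : pow_eq (pow_P 0 a) pow_1
| pow_Pn0 n : (0 < n)%N -> pow_eq (pow_P n 0) (pow_0 n)
| pow_PD n a b : pow_eq (pow_P n (a + b))
    (\big[@pow_add n/pow_0 n]_(i < n.+1)
       pow_mul (subnKC (leq_ord i)) (pow_P i a) (pow_P (n - i) b)).

HB.instance Definition _ n := gen_eqMixin (pow_term n).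
HB.instance Definition _ n := gen_choiceMixin (pow_term n).

Definition pow_eqb n (x y : pow_term n) : bool := `[< pow_eq x y >].

Lemma pow_eq_equiv n : equiv_class_of (@pow_eqb n).
Proof.
split=> [x|x y|y x z]; first exact/asboolP/pow_eq_refl.
  by apply/asboolP/asboolP; apply: pow_eq_sym.
by move=> /asboolP xy /asboolP yz; apply/asboolP/(pow_eq_trans xy).
Qed.

Canonical pow_rel n := EquivRelPack (pow_eq_equiv n).

Definition pow_comp n := {eq_quot (pow_rel n)}.
HB.instance Definition _ n := Choice.on (pow_comp n).

Definition pow_pi n (x : pow_term n) : pow_comp n := \pi_{eq_quot (pow_rel n)} x.
Definition pow_rep n (x : pow_comp n) : pow_term n := repr x.

Lemma pow_piP n (x y : pow_term n) : pow_pi x = pow_pi y <-> pow_eq x y.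
Proof. by split=> [/eqmodP/asboolP|xy] //; apply/eqmodP/asboolP. Qed.

Lemma pow_repK n (x : pow_comp n) : pow_pi (pow_rep x) = x.
Proof. exact: reprK. Qed.

Lemma pow_piK n (x : pow_term n) : pow_eq (pow_rep (pow_pi x)) x.
Proof. by apply/pow_piP; rewrite pow_repK. Qed.

Lemma pow_ind n (K : pow_comp n -> Prop) : (forall x, K (pow_pi x)) -> forall x, K x.
Proof. by move=> Kp x; rewrite -(pow_repK x). Qed.

Definition powD n (x y : pow_comp n) := pow_pi (pow_add (pow_rep x) (pow_rep y)).
Definition powN n (x : pow_comp n) := pow_pi (pow_opp (pow_rep x)).
Definition powM i j n (e : (i + j = n)%N) (x : pow_comp i) (y : pow_comp j) :=
  pow_pi (pow_mul e (pow_rep x) (pow_rep y)).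

Lemma powDE n (x y : pow_term n) : powD (pow_pi x) (pow_pi y) = pow_pi (pow_add x y).
Proof. by apply/pow_piP/pow_eq_add; apply: pow_piK. Qed.
Lemma powNE n (x : pow_term n) : powN (pow_pi x) = pow_pi (pow_opp x).
Proof. by apply/pow_piP/pow_eq_opp; apply: pow_piK. Qed.
Lemma powME i j n (e : (i + j = n)%N) (x : pow_term i) (y : pow_term j) :
  powM e (pow_pi x) (pow_pi y) = pow_pi (pow_mul e x y).
Proof. by apply/pow_piP/pow_eq_mul; apply: pow_piK. Qed.

Lemma powDA n : associative (@powD n).
Proof.
elim/pow_ind=> x; elim/pow_ind=> y; elim/pow_ind=> z; rewrite !powDE.
exact/pow_piP/pow_addA.
Qed.
Lemma powDC n : commutative (@powD n).
Proof. by elim/pow_ind=> x; elim/pow_ind=> y; rewrite !powDE; apply/pow_piP/pow_addC. Qed.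
Lemma powD0 n : left_id (pow_pi (pow_0 n)) (@powD n).
Proof. by elim/pow_ind=> x; rewrite powDE; apply/pow_piP/pow_add0. Qed.
Lemma powDN n : left_inverse (pow_pi (pow_0 n)) (@powN n) (@powD n).
Proof. by elim/pow_ind=> x; rewrite powNE powDE; apply/pow_piP/pow_addN. Qed.

HB.instance Definition _ n :=
  GRing.isZmodule.Build (pow_comp n) (@powDA n) (@powDC n) (@powD0 n) (@powDN n).

Definition Pow : cgring.
Proof.
refine (@CGRing pow_comp (pow_pi pow_1) powM _ _ _ _).
- move=> i j n e; elim/pow_ind=> x; elim/pow_ind=> x'; elim/pow_ind=> y.
  rewrite [pow_pi x + _]powDE !powME [RHS]powDE; exact/pow_piP/pow_mulDl.
- move=> i j n e e'; elim/pow_ind=> x; elim/pow_ind=> y.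
  rewrite !powME; exact/pow_piP/pow_mulC.
- move=> n e; elim/pow_ind=> x; rewrite powME; exact/pow_piP/pow_mul1.
- move=> i j k ij jk n e1 e2 e3 e4; elim/pow_ind=> x; elim/pow_ind=> y.
  elim/pow_ind=> z; rewrite !powME; exact/pow_piP/pow_mulA.
Defined.

(* The universal family; pow_lift_hom, pow_lift_univ and pow_lift_unique say
   that Pow A corepresents power families *)
Definition univ_pow (n : nat) (a : A) : Pow n := pow_pi (pow_P n a).

Lemma univ_powP : is_power_family univ_pow.
Proof.
split=> [a|n n0|n a b]; first exact/pow_piP/pow_P0.
  exact/pow_piP/pow_Pn0.
transitivity (pow_pi (\big[@pow_add n/pow_0 n]_(i < n.+1)
       pow_mul (subnKC (leq_ord i)) (pow_P i a) (pow_P (n - i) b))).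
  exact/pow_piP/pow_PD.
elim/big_rec2: _ => //= i x y _ <-; by rewrite -powDE -powME.
Qed.

Section Universal.
Variables (R : cgring) (P : forall n, A -> R n).
Hypothesis PP : is_power_family P.

Fixpoint pow_eval n (x : pow_term n) : R n :=
  match x in pow_term n return R n with
  | pow_P n a => P n a
  | pow_0 n => 0
  | pow_1 => gone R
  | pow_add n x y => pow_eval x + pow_eval y
  | pow_opp n x => - pow_eval x
  | pow_mul i j n e x y => gmul e (pow_eval x) (pow_eval y)
  end.

Lemma pow_evalE n (x y : pow_term n) : pow_eq x y -> pow_eval x = pow_eval y.
Proof.
have [P0 Pn0 PD] := PP.
elim=> //= {n x y}; try by move=> *; congruence.
- by move=> *; rewrite addrA.
- by move=> *; rewrite addrC.
- by move=> *; rewrite add0r.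
- by move=> *; rewrite addNr.
- by move=> *; rewrite gmulDl.
- by move=> *; apply: gmulC.
- by move=> *; rewrite g1mul.
- by move=> *; apply: gmulA.
- move=> n a b; rewrite PD; elim/big_rec2: _ => //= i x y _ ->.
  by [].
Qed.

Definition pow_lift n (x : Pow n) : R n := pow_eval (pow_rep x).

Lemma pow_liftE n (x : pow_term n) : pow_lift (pow_pi x) = pow_eval x.
Proof. exact/pow_evalE/pow_piK. Qed.

Lemma pow_lift_hom : gr_hom pow_lift.
Proof.
split=> [n||i j n e].
- by elim/pow_ind=> x; elim/pow_ind=> y; rewrite [_ + _]powDE !pow_liftE.
- by rewrite pow_liftE.
- by elim/pow_ind=> x; elim/pow_ind=> y; rewrite [gmul _ _ _]powME !pow_liftE.
Qed.

Lemma pow_lift_univ n a : pow_lift (univ_pow n a) = P n a.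
Proof. exact: pow_liftE. Qed.

Lemma pow_lift_unique (f : forall n, Pow n -> R n) : gr_hom f ->
  (forall n a, f n (univ_pow n a) = P n a) -> forall n x, f n x = pow_lift x.
Proof.
move=> [fD f1 fM] fP n; elim/pow_ind=> x; rewrite pow_liftE.
elim: n / x => /= [n a|n||n x IHx y IHy|n x IHx|i j n e x IHx y IHy] //.
- exact: fP.
- exact: (morphD0 (@fD n)).
- by rewrite -IHx -IHy -fD [_ + _]powDE.
- by rewrite -IHx -(morphDN (@fD n)) [- _]powNE.
- by rewrite -IHx -IHy -fM [gmul _ _ _]powME.
Qed.

End Universal.
End Pow.

Local Open Scope classical_set_scope.

Section SubGsets.
Variable gT : finGroupType.
Implicit Types W X Y : gset gT.

Definition invariant_pred W (A : pred W) := forall a x, A x -> A (lact a x).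

Definition gsub_act W (A : pred W) (AI : invariant_pred A) (a : gT)
  (u : {x : W | A x}) : {x : W | A x} := exist _ (lact a (sval u)) (AI a _ (svalP u)).

Definition gsub W (A : pred W) (AI : invariant_pred A) : gset gT.
Proof.
exists {x : W | A x} (gsub_act AI) => [u|a b u].
  by apply: val_inj; rewrite /= lact1.
by apply: val_inj; rewrite /= lactM.
Defined.

Definition embeds X Y := exists f : X -> Y, injective f /\ equivariant f.

Lemma embeds_trans Y X W : embeds X Y -> embeds Y W -> embeds X W.
Proof.
move=> [f [fi fE]] [g [gi gE]]; exists (g \o f); split; first exact: inj_comp.
by move=> a x; rewrite /= fE gE.
Qed.

Lemma giso_embeds X Y : giso X Y -> embeds X Y.
Proof. by case=> f [fb fE]; exists f; split=> //; apply: bij_inj. Qed.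

Lemma gsub_embeds W (A : pred W) (AI : invariant_pred A) : embeds (gsub AI) W.
Proof. by exists val; split=> //; apply: val_inj. Qed.

Lemma gsub_split W (A B C : pred W) (AI : invariant_pred A)
    (BI : invariant_pred B) (CI : invariant_pred C) :
  (forall x, A x = B x || C x) -> (forall x, B x -> C x -> False) ->
  giso (gsum (gsub BI) (gsub CI)) (gsub AI).
Proof.
move=> ABC BC.
have AB x : B x -> A x by rewrite ABC => ->.
have AC x : C x -> A x by rewrite ABC orbC => ->.
pose f (u : gsum (gsub BI) (gsub CI)) : gsub AI := match u with
  inl v => exist _ (sval v) (AB _ (svalP v)) | inr v => exist _ (sval v) (AC _ (svalP v)) end.
apply: (@giso_inj_surj _ _ _ f).
- move=> [[x Bx]|[x Cx]] [[y By]|[y Cy]] /(congr1 val) /= E.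
  + by congr inl; apply: val_inj.
  + by case: (BC x) => //; rewrite E.
  + by case: (BC y) => //; rewrite -E.
  + by congr inr; apply: val_inj.
- move=> [x Ax]; have := Ax; rewrite ABC => /orP[Bx|Cx].
    by exists (inl (exist _ x Bx)); apply: val_inj.
  by exists (inr (exist _ x Cx)); apply: val_inj.
- by move=> a [u|u]; apply: val_inj.
Qed.

Lemma gsubT W (A : pred W) (AI : invariant_pred A) :
  (forall x, A x) -> giso (gsub AI) W.
Proof.
move=> AT; apply: (@giso_inj_surj _ (gsub AI) W val) => //; first exact: val_inj.
by move=> x; exists (exist _ x (AT x)).
Qed.

Lemma gsub_empty W (A : pred W) (AI : invariant_pred A) :
  (forall x, ~~ A x) -> giso (gempty gT) (gsub AI).
Proof.
move=> A0; apply: (@giso_inj_surj _ (gempty gT) (gsub AI)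
  (fun u : void => match u with end)); [by case|by case=> x Ax; case/negP: (A0 x)|by []].
Qed.

Lemma bcls_level W (d : W -> nat) (dI : forall a x, d (lact a x) = d x)
    (LI : forall k, invariant_pred (fun x => d x == k)) N :
  (forall x, (d x < N)%N) -> bcls W = \sum_(k < N) bcls (gsub (LI k)).
Proof.
move=> dN.
have MI k : invariant_pred (fun x => d x < k)%N by move=> a x; rewrite dI.
rewrite -(bclsP_iso (gsubT (MI N) dN)); elim: N {dN} => [|N IH].
  by rewrite big_ord0 -(bclsP_iso (gsub_empty (MI 0%N) _)).
rewrite big_ord_recr /= -IH -bclsD; apply/bclsP_iso/giso_sym/gsub_split => x.
  by rewrite ltnS leq_eqVlt orbC.
by move=> /[swap] /eqP ->; rewrite ltnn.
Qed.

End SubGsets.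

Lemma is_induced_embed (hT gT : finGroupType) (iota : hT -> gT) (Z : gset hT)
    (V W : gset gT) (s : Z -> V) (f : Z -> W) :
  is_induced iota s -> (forall h z, f (lact h z) = lact (iota h) (f z)) ->
  (forall a z z', lact a (f z) = f z' -> exists h, a = iota h /\ z' = lact h z) ->
  embeds V W.
Proof.
move=> sI fE fk.
have ker a a' z z' : lact a (s z) = lact a' (s z') <-> lact a (f z) = lact a' (f z').
  rewrite (is_induced_kernel sI); split=> [[h [E ->]]|E].
    by rewrite fE -E -lactM mulgA mulgV mul1g.
  by apply: fk; rewrite lactM E lactK.
have [_ ss _] := sI.
have ss2 w : exists p : gT * Z, w = lact p.1 (s p.2).
  by have [a [z ->]] := ss w; exists (a, z).
pose r w := projT1 (cid (ss2 w)).
have rE w : w = lact (r w).1 (s (r w).2) by rewrite /r; case: cid.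
pose F (w : V) : W := lact (r w).1 (f (r w).2).
have FE a z : F (lact a (s z)) = lact a (f z) by apply/ker; rewrite -rE.
exists F; split; first by move=> w w' /ker; rewrite -!rE.
by move=> a w; rewrite [in LHS](rE w) -lactM FE /F -[in RHS]lactM.
Qed.

Section PowerSum.
Variables (gT : finGroupType) (X Y : gset gT).

Definition is_left (A B : Type) (u : A + B) := if u is inl _ then true else false.

Definition nleft n (w : gpow n (gsum X Y)) : nat := \sum_(m < n) is_left (w m).

Lemma nleft_lact n a (w : gpow n (gsum X Y)) : nleft (lact a w) = nleft w.
Proof.
rewrite /nleft [RHS](reindex_inj (@perm_inj _ (wperm a)^-1%g)).
by apply: eq_bigr => m _; rewrite ffunE /=; case: (w _).
Qed.

Definition gmerge i j n (e : (i + j = n)%N) (z : gxprod (gpow i X) (gpow j Y)) :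
  gpow n (gsum X Y) := [ffun m => match unblk e m with
    inl a => inl (z.1 a) | inr b => inr (z.2 b) end].

Lemma gmergeE i j n (e : (i + j = n)%N) z u : gmerge e z (blk e u) =
  match u with inl a => inl (z.1 a) | inr b => inr (z.2 b) end.
Proof. by rewrite ffunE blkK. Qed.

Lemma gmerge_lact i j n (e : (i + j = n)%N) h z :
  gmerge e (lact h z) = lact (wembed e h) (gmerge e z).
Proof.
apply/ffunP; apply: (blkP (e := e)) => u; rewrite [RHS]ffunE wembed_permV !gmergeE.
by rewrite wembed_tup; case: u => a; rewrite /= ffunE.
Qed.

Lemma gmerge_fibre i j n (e : (i + j = n)%N) c z z' :
  lact c (gmerge e z) = gmerge e z' -> exists h, c = wembed e h /\ z' = lact h z.
Proof.
move=> E.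
have Em m : gmerge e z' (wperm c m) = lact (wtup c (wperm c m)) (gmerge e z m).
  by rewrite -E ffunE permK.
have El a : exists a', wperm c (blk e (inl a)) = blk e (inl a').
  have := Em (blk e (inl a)); rewrite gmergeE -(unblkK e (wperm c _)) gmergeE.
  by case: (unblk _ _) => // a' _; exists a'.
have Er a : exists a', wperm c (blk e (inr a)) = blk e (inr a').
  have := Em (blk e (inr a)); rewrite gmergeE -(unblkK e (wperm c _)) gmergeE.
  by case: (unblk _ _) => // a' _; exists a'.
pose sf a := projT1 (cid (El a)); pose tf a := projT1 (cid (Er a)).
have sfE a : wperm c (blk e (inl a)) = blk e (inl (sf a)) by rewrite /sf; case: cid.
have tfE a : wperm c (blk e (inr a)) = blk e (inr (tf a)) by rewrite /tf; case: cid.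
have si : injective sf.
  move=> a a' saa; have : blk e (inl a) = blk e (inl a').
    by apply: (perm_inj (s := wperm c)); rewrite !sfE saa.
  by move/(can_inj (blkK e)) => -[].
have ti : injective tf.
  move=> a a' taa; have : blk e (inr a) = blk e (inr a').
    by apply: (perm_inj (s := wperm c)); rewrite !tfE taa.
  by move/(can_inj (blkK e)) => -[].
pose h : wreath gT i * wreath gT j :=
  (Wreath [ffun a => wtup c (blk e (inl a))] (perm si),
   Wreath [ffun a => wtup c (blk e (inr a))] (perm ti)).
have hE : c = wembed e h.
  apply: wreathP; apply: (blkP (e := e)) => u.
    by rewrite wembed_tup; case: u => a; rewrite ffunE.
  by rewrite wembed_perm; case: u => a; rewrite permE ?sfE ?tfE.
exists h; split=> //; rewrite hE -gmerge_lact in E.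
case: (lact h z) z' E {Em} => [x y] [x' y'] E; congr pair; apply/ffunP => a.
  by have := congr1 (fun w : {ffun _ -> _} => w (blk e (inl a))) E; rewrite !gmergeE => -[].
by have := congr1 (fun w : {ffun _ -> _} => w (blk e (inr a))) E; rewrite !gmergeE => -[].
Qed.

Lemma nleft_merge i j n (e : (i + j = n)%N) z : nleft (gmerge e z) = i.
Proof.
rewrite /nleft (reindex (blk e)); last first.
  by apply: onW_bij; exists (unblk e); [apply: blkK|apply: unblkK].
rewrite big_sumType /= [X in (_ + X)%N]big1 => [|b _]; last by rewrite gmergeE.
rewrite (eq_bigr (fun=> 1%N)) => [|a _]; last by rewrite gmergeE.
by rewrite sum1_card card_ord addn0.
Qed.

Lemma gmerge_surj i j n (e : (i + j = n)%N) (w : gpow n (gsum X Y)) :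
  nleft w = i -> exists c z, w = lact c (gmerge e z).
Proof.
move=> wi; pose A := [set m | is_left (w m)]%SET.
have cA : #|A| = i.
  by rewrite -wi /nleft -sum1_card big_mkcond; apply: eq_bigr => m _; rewrite inE; case: is_left.
have cAC : #|~: A| = j by rewrite cardsCs finset.setCK cA card_ord -e addKn.
pose g (u : 'I_i + 'I_j) : 'I_n := match u with
  inl a => enum_val (cast_ord (esym cA) a) | inr b => enum_val (cast_ord (esym cAC) b) end.
have gA u : is_left (w (g u)) = is_left u.
  case: u => a; rewrite /g.
    by have := enum_valP (cast_ord (esym cA) a); rewrite inE.
  by have := enum_valP (cast_ord (esym cAC) a); rewrite !inE => /negbTE.
have gi : injective g.
  move=> u v guv; have := gA u; rewrite guv gA.
  by case: u v guv => a [] b //= /enum_val_inj /cast_ord_inj ->.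
have si : injective (g \o unblk e) by apply: inj_comp gi (can_inj (unblkK e)).
have sE u : perm si (blk e u) = g u by rewrite permE /= blkK.
have xE a : exists x, w (g (inl a)) = inl x.
  by have := gA (inl a); case: (w _) => // x _; exists x.
have yE a : exists y, w (g (inr a)) = inr y.
  by have := gA (inr a); case: (w _) => // y _; exists y.
exists (Wreath [ffun=> 1%g] (perm si)).
exists ([ffun a => projT1 (cid (xE a))], [ffun a => projT1 (cid (yE a))]).
apply/ffunP => m; rewrite [RHS]ffunE [wtup _ m]ffunE lact1 [wperm _]/=.
pose k := (perm si)^-1%g m; have mE : m = perm si k by rewrite permKV.
rewrite -/k {1}mE -(unblkK e k) sE gmergeE; case: (unblk e k) => a; rewrite ffunE; by case: cid.
Qed.

Lemma gpow_sum n : bcls (gpow n (gsum X Y)) =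
  \sum_(i < n.+1) star (subnKC (leq_ord i)) (bcls (gpow i X)) (bcls (gpow (n - i) Y)).
Proof.
have LI k : invariant_pred (fun w : gpow n (gsum X Y) => nleft w == k).
  by move=> a w; rewrite nleft_lact.
rewrite (@bcls_level _ _ (@nleft n) (@nleft_lact n) LI n.+1) => [|w]; last first.
  rewrite ltnS -[X in (_ <= X)%N]card_ord -sum1_card.
  by apply: leq_sum => m _; case: is_left.
apply: eq_bigr => i _; rewrite starE; apply/bclsP_iso/giso_sym.
set e := subnKC _.
have zL z : nleft (gmerge e z) == i by rewrite nleft_merge.
apply: (@transfer_isoP _ _ _ _ e _ _ _ (fun z => exist _ (gmerge e z) (zL z) : gsub (LI i))).
split=> [h z|[w wi]|c z z' /(congr1 val)].
- by apply: val_inj; apply: gmerge_lact.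
- have [c [z E]] := gmerge_surj e (eqP wi).
  by exists c, z; apply: val_inj.
- exact: gmerge_fibre.
Qed.

End PowerSum.

Lemma gpow_iso (gT : finGroupType) n (X Y : gset gT) : giso X Y -> giso (gpow n X) (gpow n Y).
Proof.
case=> f [[g fK gK] fE]; exists (fun x : gpow n X => [ffun i => f (x i)] : gpow n Y); split.
  by exists (fun x : gpow n Y => [ffun i => g (x i)] : gpow n X) => x; apply/ffunP => i;
     rewrite !ffunE ?fK ?gK.
by move=> a x; apply/ffunP => i; rewrite !ffunE fE.
Qed.

Lemma gpow0 (gT : finGroupType) (X : gset gT) : giso (gpow 0 X) (gpoint _).
Proof.
apply: (@giso_inj_surj _ (gpow 0 X) (gpoint _) (fun=> tt)) => //.
  by move=> x y _; apply/ffunP => -[].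
by case; exists ([ffun i : 'I_0 => match (i : 'I_0) with Ordinal _ p => match notF p with end end]).
Qed.

Section TotalPower.
Variable gT : finGroupType.

(* P_n(0) = 0 for n > 0 follows from the first clause (see aring_pow_family) *)
Definition is_total_power (P : forall n, burnside gT -> burnside_wreath gT n) :=
  [/\ forall n X, P n (bcls X) = bcls (gpow n X),
      forall x, P 0%N x = gone (burnside_wreath gT) &
      forall n x y, P n (x + y) =
        \sum_(i < n.+1) gmul (subnKC (leq_ord i)) (P i x) (P (n - i)%N y)].

Lemma total_power_exists : exists P, is_total_power P.
Proof.
have s0 (c : isoclass gT) : bcls (gpow 0 (rep c)) = gone (burnside_wreath gT).
  by apply/bclsP_iso/gpow0.
pose s c := @GSeries (burnside_wreath gT) (fun n => bcls (gpow n (rep c))) (s0 c).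
have sD : {morph s : c d / c + d}.
  move=> c d; apply: gserP => n; 
  transitivity (bcls (gpow n (gsum (rep c) (rep d)))); last exact: gpow_sum.
  apply/bclsP_iso/gpow_iso; rewrite -{1}(clsK c) -{1}(clsK d) -clsD; exact: repK.
exists (fun n x => gser (groth_ext s x) n); split=> [n X|x|n x y].
- by rewrite groth_ext_in //; apply/bclsP_iso/gpow_iso/repK.
- exact: gser0.
- by rewrite groth_extD.
Qed.

Lemma total_power_sub P : is_total_power P -> forall x y n,
  P n (x - y) = gconv (P^~ x) (ginv (P^~ y)) n.
Proof.
move=> [_ P0 PD] x y.
apply: (gconv_unique (p := P^~ y)) => // n.
rewrite -[LHS]PD addrC subrK gconvA.
have E m : gconv (P^~ y) (P^~ x) m = gconv (P^~ x) (P^~ y) m by apply: gconvC.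
rewrite (gconv_ext (p' := gconv (P^~ x) (P^~ y)) (q' := ginv (P^~ y))) //.
rewrite -gconvA gconvC (gconv_ext (p' := @gunit _) (q' := P^~ x)) ?gunit_conv //.
by move=> i _; rewrite gconvC ginvP.
Qed.

Lemma total_power_unique P Q : is_total_power P -> is_total_power Q ->
  forall n x, P n x = Q n x.
Proof.
move=> PT QT n x; elim/burnside_ind: x n => [X|x y Ex Ey] n.
  by case: PT QT => PX _ _ [QX _ _]; rewrite PX QX.
rewrite (total_power_sub PT) (total_power_sub QT); apply: gconv_ext => i _ //.
suff -> : P^~ y = Q^~ y by [].
exact: functional_extensionality_dep.
Qed.

(* The total power operations: unique by total_power_unique *)
Definition totpow : forall n, burnside gT -> burnside_wreath gT n :=
  projT1 (cid total_power_exists).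

Lemma totpowP : is_total_power totpow.
Proof. by rewrite /totpow; case: cid. Qed.

End TotalPower.

Section Span.
Variable V : zmodType.
Implicit Types S T : set V.

Definition is_subgroup T := T 0 /\ forall x y, T x -> T y -> T (x - y).

(* The Z-span of S *)
Definition zspan S : set V := smallest is_subgroup S.

Lemma zspan_subgroup S : is_subgroup (zspan S).
Proof.
split=> [T [[T0 _] _] //|x y Sx Sy T /= TS].
by case: (TS) => -[_ TB] _; apply: TB; [apply: Sx|apply: Sy].
Qed.

Lemma zspan_in S : S `<=` zspan S.
Proof. exact: sub_gen_smallest. Qed.

Lemma zspan_min S T : is_subgroup T -> S `<=` T -> zspan S `<=` T.
Proof. by move=> Tg ST x; apply; split. Qed.

Lemma zspan0 S : zspan S 0. Proof. by case: (zspan_subgroup S). Qed.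
Lemma zspanB S x y : zspan S x -> zspan S y -> zspan S (x - y).
Proof. by case: (zspan_subgroup S) => _; apply. Qed.
Lemma zspanD S x y : zspan S x -> zspan S y -> zspan S (x + y).
Proof. by move=> Sx Sy; rewrite -[y]opprK -[- y]sub0r; apply: zspanB => //; apply: zspanB => //; apply: zspan0. Qed.
Lemma zspan_sum S (I : Type) (s : seq I) (F : I -> V) :
  (forall i, zspan S (F i)) -> zspan S (\sum_(i <- s) F i).
Proof. by move=> SF; elim/big_ind: _ => //; [apply: zspan0|apply: zspanD]. Qed.
End Span.

(* The canonical basis *)
Definition trans_basis (gT : finGroupType) : set (burnside gT) :=
  [set b | exists X : gset gT, gtransitive X /\ b = bcls X].

Arguments trans_basis gT : clear implicits.

Section Detect.
Variables (gT : finGroupType) (T : gset gT).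
Hypothesis Tt : gtransitive T.

(* x lies in an orbit isomorphic to T *)
Definition hits (X : gset gT) (x : X) : bool :=
  `[< exists f : T -> X, [/\ injective f, equivariant f & exists t, f t = x] >].

Definition nhits (X : gset gT) : nat := \sum_(x : X) hits x.

Lemma nhits_iso X Y : giso X Y -> nhits X = nhits Y.
Proof.
suff le Z W : giso Z W -> (nhits Z <= nhits W)%N.
  by move=> XY; apply/eqP; rewrite eqn_leq !le //; apply: giso_sym.
case=> f [fb fE]; rewrite /nhits [leqRHS](reindex f); last exact: onW_bij.
apply: leq_sum => z _; suff: hits z -> hits (f z) by case: (hits z) => // ->.
move=> /asboolP[g [gi gE [t gt]]].
apply/asboolP; exists (f \o g); split=> [|a u|].
- exact: inj_comp (bij_inj fb) gi.
- by rewrite /= gE fE.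
- by exists t; rewrite /= gt.
Qed.

Lemma nhits_sum X Y : nhits (gsum X Y) = (nhits X + nhits Y)%N.
Proof.
rewrite /nhits big_sumType /=; congr (_ + _)%N; apply: eq_bigr => x _; congr nat_of_bool.
  apply/asboolP/asboolP => -[f [fi fE [t ft]]]; last first.
    exists (inl \o f); split=> [u v [] /fi //|a u|]; first by rewrite /= fE.
    by exists t; rewrite /= ft.
  have fl u : exists x', f u = inl x'.
    have [a <-] := (proj2 Tt) t u; rewrite fE ft /=; by eexists.
  exists (fun u => projT1 (cid (fl u))); split=> [u v|a u|].
  - case: cid => y /= uy; case: cid => z /= vz yz.
    by apply: fi; rewrite uy vz yz.
  - case: cid => y /= uy; case: cid => z /= vz.
    by move: uy; rewrite fE vz => -[].
  - by exists t; case: cid => y /=; rewrite ft => -[].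
apply/asboolP/asboolP => -[f [fi fE [t ft]]]; last first.
  exists (inr \o f); split=> [u v [] /fi //|a u|]; first by rewrite /= fE.
  by exists t; rewrite /= ft.
have fl u : exists x', f u = inr x'.
  have [a <-] := (proj2 Tt) t u; rewrite fE ft /=; by eexists.
exists (fun u => projT1 (cid (fl u))); split=> [u v|a u|].
- case: cid => y /= uy; case: cid => z /= vz yz.
  by apply: fi; rewrite uy vz yz.
- case: cid => y /= uy; case: cid => z /= vz.
  by move: uy; rewrite fE vz => -[].
- by exists t; case: cid => y /=; rewrite ft => -[].
Qed.

Definition detect : burnside gT -> int := groth_ext (fun c => (nhits (rep c))%:Z).

Let nhitsD : {morph (fun c => (nhits (@rep gT c))%:Z) : c d / c + d}.
Proof.
move=> c d; rewrite -PoszD -nhits_sum; congr Posz; apply: nhits_iso.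
by rewrite -{1}(clsK c) -{1}(clsK d) -clsD; apply: repK.
Qed.

Lemma detectE X : detect (bcls X) = (nhits X)%:Z.
Proof. by rewrite /detect groth_ext_in //; congr Posz; apply/nhits_iso/repK. Qed.

Lemma detectB : {morph detect : x y / x - y}.
Proof. by apply: morphDB; apply: groth_extD. Qed.

Lemma detect_embeds X : embeds T X -> detect (bcls X) != 0.
Proof.
move=> [f [fi fE]]; rewrite detectE; have [[t _] _] := Tt.
suff H : hits (f t) by rewrite /nhits (bigD1 (f t)) //= H.
by apply/asboolP; exists f; split=> //; exists t.
Qed.

Lemma detect_trans X : gtransitive X -> detect (bcls X) != 0 -> giso T X.
Proof.
move=> [_ Xt]; rewrite detectE => nz.
have [x /asboolP[f [fi fE [t ft]]]] : exists x : X, hits x.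
  apply: contrapT => no; case/negP: nz; rewrite /nhits big1 // => x _.
  by case E: (hits x) => //; case: no; exists x.
apply: (giso_inj_surj fi) => // y.
by have [a <-] := Xt (f t) y; exists (lact a t); rewrite fE.
Qed.

Lemma zspan_detect (S : set (burnside gT)) x : S `<=` trans_basis gT ->
  zspan S x -> detect x != 0 -> S (bcls T).
Proof.
move=> Sb; apply: (zspan_min (T := [set x | detect x != 0 -> S (bcls T)])).
  split=> [|y z Hy Hz] /=; first by rewrite /detect (morphD0 (groth_extD nhitsD)) eqxx.
  rewrite detectB => nz; have [y0|/Hy //] := eqVneq (detect y) 0.
  by apply: Hz; apply: contraNneq nz => ->; rewrite y0 subr0.
move=> b Sb' /= nz; have [X [Xt bE]] := Sb _ Sb'.
by rewrite (bclsP_iso (detect_trans Xt _)) -?bE.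
Qed.

End Detect.

Section Orbits.
Variable gT : finGroupType.

Lemma orbit_decomposition (X : gset gT) :
  zspan [set b | exists T, [/\ gtransitive T, embeds T X & b = bcls T]] (bcls X).
Proof.
pose S := [set b | exists T, [/\ gtransitive T, embeds T X & b = bcls T]].
suff main m (Y : gset gT) : (#|Y| <= m)%N -> embeds Y X -> zspan S (bcls Y).
  exact: main (leqnn _) (giso_embeds (giso_refl X)).
elim: m Y => [|m IH] Y Ym YX.
  have -> : bcls Y = 0; last exact: zspan0.
  rewrite -bcls0; apply/bclsP_iso/giso_sym.
  apply: (@giso_inj_surj _ (gempty gT) Y (fun u : void => match u with end));
    [by case| |by []].
  by move=> y; move: Ym; rewrite leqn0 => /eqP/card0_eq/(_ y).
have [[y _]|no] := pselect (exists y : Y, True); last first.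
  apply: IH => //; rewrite eq_card0 // => y.
  by case: no; exists y.
pose A (z : Y) := [exists a, lact a y == z].
have AI : invariant_pred A.
  by move=> a z /existsP[b /eqP <-]; apply/existsP; exists (a * b)%g; rewrite lactM.
have CI : invariant_pred (fun z => ~~ A z).
  by move=> a z; apply: contra => /(AI a^-1%g); rewrite lactK.
have TI : invariant_pred (fun _ : Y => true) by [].
rewrite -(bclsP_iso (gsubT TI (fun _ => erefl))).
rewrite -(bclsP_iso (@gsub_split _ _ _ _ _ TI AI CI _ _)); last first.
- by move=> z Az /negP.
- by move=> z; rewrite orbN.
rewrite bclsD; apply: zspanD.
  apply: zspan_in; exists (gsub AI); split=> //.
  - have Ay : A y by apply/existsP; exists 1%g; rewrite lact1.
    split; first by exists (exist _ y Ay).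
    move=> [u Au] [v Av]; have /existsP[a /eqP ua] := Au; have /existsP[b /eqP vb] := Av.
    exists (b * a^-1)%g; apply: val_inj; rewrite /= lactM -vb -ua.
    by rewrite lactK.
  - exact: embeds_trans (gsub_embeds AI) YX.
apply: IH; last exact: embeds_trans (gsub_embeds CI) YX.
rewrite -ltnS; apply: leq_trans Ym; rewrite card_sig.
apply/proper_card/properP; split; first exact/fintype.subsetP.
exists y => //; rewrite inE negbK; apply/existsP; exists 1%g; by rewrite lact1.
Qed.

End Orbits.

Section PowerBasis.
Variable gT : finGroupType.

(* The smallest subset of the canonical basis whose span contains the image of
   the n-th total power operation: "smallest C set0" is the intersection of all
   sets satisfying C, and power_basis_least shows that it satisfies C itself *)
Definition power_basis n : set (burnside (wreath gT n)) :=
  smallest [set S | S `<=` trans_basis _ /\ range (@totpow gT n) `<=` zspan S] set0.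

Arguments power_basis n : clear implicits.

(* Orbits of the powers of honest gT-sets; equal to power_basis (power_basisE) *)
Definition power_orbits n : set (burnside (wreath gT n)) :=
  [set b | exists T (Z : gset gT),
    [/\ gtransitive T, embeds T (gpow n Z) & b = bcls T]].

Arguments power_orbits n : clear implicits.

Lemma gpow_orbits n (Z : gset gT) (W : gset (wreath gT n)) :
  embeds W (gpow n Z) -> zspan (power_orbits n) (bcls W).
Proof.
move=> WZ; have := @orbit_decomposition _ W.
set S := (X in zspan X _); suff H : S `<=` zspan (power_orbits n).
  exact: (zspan_min (zspan_subgroup _) H).
move=> b [T [Tt TW ->]]; apply: zspan_in; exists T, Z; split=> //.
exact: embeds_trans WZ.
Qed.

Lemma transfer_embeds i j n (e : (i + j = n)%N) (T : gset (wreath gT i))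
    (T' : gset (wreath gT j)) (Z Z' : gset gT) :
  embeds T (gpow i Z) -> embeds T' (gpow j Z') ->
  embeds (transfer e T T') (gpow n (gsum Z Z')).
Proof.
move=> [f [fi fE]] [g [gi gE]]; have [s sI] := transfer_is e T T'.
pose F (z : gxprod T T') : gpow n (gsum Z Z') :=
  gmerge e ((f z.1, g z.2) : gxprod (gpow i Z) (gpow j Z')).
apply: (@is_induced_embed _ _ _ _ _ _ s F sI) => [h z|a z z']; rewrite /F.
  by rewrite -gmerge_lact /= fE gE.
move/gmerge_fibre => [h [-> E]]; exists h; split=> //.
case: z z' E => [x y] [x' y'] /= [Ex Ey]; congr pair.
  by apply: fi; rewrite Ex fE.
by apply: gi; rewrite Ey gE.
Qed.

Lemma power_orbits_star i j n (e : (i + j = n)%N) x y :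
  zspan (power_orbits i) x -> zspan (power_orbits j) y ->
  zspan (power_orbits n) (star e x y).
Proof.
move=> Sx Sy.
suff H : zspan (power_orbits i) `<=` [set x | zspan (power_orbits n) (star e x y)].
  exact: H.
apply: zspan_min.
  split=> [|x1 x2 H1 H2] /=; first by rewrite (morphD0 (starDl e y)); apply: zspan0.
  by rewrite starBl; apply: zspanB.
move=> _ [T [Z [Tt TZ ->]]] /=.
suff H : zspan (power_orbits j) `<=` [set y | zspan (power_orbits n) (star e (bcls T) y)].
  exact: H.
apply: zspan_min.
  split=> [|x1 x2 H1 H2] /=; first by rewrite (morphD0 (starDr e _)); apply: zspan0.
  by rewrite starBr; apply: zspanB.
move=> _ [T' [Z' [T't TZ' ->]]] /=; rewrite starE.
exact: gpow_orbits (transfer_embeds e TZ TZ').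
Qed.

Lemma power_orbits_one : zspan (power_orbits 0) (gone (burnside_wreath gT)).
Proof.
apply: (@gpow_orbits _ (gempty gT)); apply/giso_embeds/giso_sym/gpow0.
Qed.

Let P := @totpow gT.
Let R := burnside_wreath gT.

Let gmulx_in n i j (x : R i) (y : R j) :
  zspan (power_orbits i) x -> zspan (power_orbits j) y ->
  zspan (power_orbits n) (gmulx n x y).
Proof.
move=> Sx Sy; rewrite /gmulx; case: eqP => [e|_]; last exact: zspan0.
exact: power_orbits_star.
Qed.

Lemma totpow_orbits n x : zspan (power_orbits n) (P n x).
Proof.
have [PX P0 _] := @totpowP gT.
elim/burnside_ind: x n => [X|x y Sx Sy] n.
  by rewrite /P PX; apply: (@gpow_orbits _ X); apply/giso_embeds/giso_refl.
rewrite /P (total_power_sub (@totpowP gT)).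
have Si m : zspan (power_orbits m) (ginv ((@totpow gT)^~ y) m).
  elim/ltn_ind: m => m IH; rewrite ginvE; apply: zspanB.
    by case: m {IH} => [|m]; [apply: power_orbits_one|apply: zspan0].
  apply: zspan_sum => i; apply: gmulx_in; first exact: Sy.
  by apply: IH; rewrite ltn_subrL /=; apply: leq_trans (ltn_ord i).
apply: zspan_sum => i; apply: power_orbits_star; [exact: Sx|exact: Si].
Qed.

Lemma power_basisE n : power_basis n = power_orbits n.
Proof.
have bas : power_orbits n `<=` trans_basis _.
  by move=> _ [T [Z [Tt _ ->]]]; exists T.
apply/seteqP; split=> [b|_ [T [Z [Tt TZ ->]]] S /= [[Sb SP] _]].
  apply; split=> //; split=> // _ [x _ <-]; exact: totpow_orbits.
apply: (zspan_detect Tt Sb (x := totpow n (bcls Z))); first by apply: SP; exists (bcls Z).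
by case: (totpowP gT) => -> _ _; apply: detect_embeds.
Qed.

Lemma power_basis_least n :
  [/\ power_basis n `<=` trans_basis _,
      range (@totpow gT n) `<=` zspan (power_basis n) &
      forall S, S `<=` trans_basis _ -> range (@totpow gT n) `<=` zspan S ->
        power_basis n `<=` S].
Proof.
split=> [||S Sb SP b]; last by apply; split.
  by rewrite power_basisE => _ [T [Z [Tt _ ->]]]; exists T.
by rewrite power_basisE => _ [x _ <-]; apply: totpow_orbits.
Qed.

End PowerBasis.

Arguments power_basis gT n : clear implicits.

(* A graded subring as a graded ring *)
Section GradedSubring.
Variables (R : cgring) (S : forall n, set (R n)).
Hypothesis SG : forall n, is_subgroup (@S n).
Hypothesis S1 : @S 0%N (gone R).
Hypothesis SM : forall i j n (e : (i + j = n)%N) x y,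
  @S i x -> @S j y -> @S n (gmul e x y).

Record gsubset n := GSubset { gsval : R n; gsvalP : @S n gsval }.

HB.instance Definition _ n := gen_eqMixin (gsubset n).
HB.instance Definition _ n := gen_choiceMixin (gsubset n).

Lemma gsval_inj n : injective (@gsval n).
Proof. by move=> [x Sx] [y Sy] /= E; move: Sy; rewrite -E => Sy; congr GSubset; apply: Prop_irrelevance. Qed.

Let S0 n : @S n 0. Proof. by case: (SG n). Qed.
Let SN n x : @S n x -> @S n (- x).
Proof. by move=> Sx; rewrite -sub0r; case: (SG n) => _; apply. Qed.
Let SD n x y : @S n x -> @S n y -> @S n (x + y).
Proof. by move=> Sx Sy; rewrite -[y]opprK; case: (SG n) => _; apply=> //; apply: SN. Qed.

Definition gs0 n := GSubset (S0 n).
Definition gsD n (x y : gsubset n) := GSubset (SD (gsvalP x) (gsvalP y)).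
Definition gsN n (x : gsubset n) := GSubset (SN (gsvalP x)).

Lemma gsDA n : associative (@gsD n).
Proof. by move=> x y z; apply: gsval_inj; apply: addrA. Qed.
Lemma gsDC n : commutative (@gsD n).
Proof. by move=> x y; apply: gsval_inj; apply: addrC. Qed.
Lemma gsD0 n : left_id (gs0 n) (@gsD n).
Proof. by move=> x; apply: gsval_inj; apply: add0r. Qed.
Lemma gsDN n : left_inverse (gs0 n) (@gsN n) (@gsD n).
Proof. by move=> x; apply: gsval_inj; apply: addNr. Qed.

HB.instance Definition _ n :=
  GRing.isZmodule.Build (gsubset n) (@gsDA n) (@gsDC n) (@gsD0 n) (@gsDN n).

Definition gsubring : cgring.
Proof.
refine (@CGRing gsubset (GSubset S1)
  (fun i j n e x y => GSubset (SM e (gsvalP x) (gsvalP y))) _ _ _ _).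
- by move=> *; apply: gsval_inj; apply: gmulDl.
- by move=> *; apply: gsval_inj; apply: gmulC.
- by move=> *; apply: gsval_inj; apply: g1mul.
- by move=> *; apply: gsval_inj; apply: gmulA.
Defined.

End GradedSubring.

Section Aring.
Variable gT : finGroupType.

(* The summand of A(gT wr 'S_n) spanned by power_basis *)
Definition aring_set n : set (burnside_wreath gT n) := zspan (power_basis gT n).

Lemma aring_subgroup n : is_subgroup (@aring_set n).
Proof. exact: zspan_subgroup. Qed.

Lemma aring_one : aring_set (gone (burnside_wreath gT)).
Proof. by rewrite /aring_set power_basisE; apply: power_orbits_one. Qed.

Lemma aring_mul i j n (e : (i + j = n)%N) (x : burnside_wreath gT i) (y : burnside_wreath gT j) :
  aring_set x -> aring_set y -> aring_set (gmul e x y).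
Proof. by rewrite /aring_set !power_basisE; apply: power_orbits_star. Qed.

Lemma aring_totpow n x : aring_set (@totpow gT n x).
Proof. by case: (@power_basis_least gT n) => _ H _; apply: H; exists x. Qed.

(* The graded subring written A(G) with a ring accent *)
Definition aring : cgring := gsubring aring_subgroup aring_one aring_mul.

(* The total power operations, with values in aring *)
Definition aring_pow n (x : burnside gT) : aring n := GSubset (@aring_totpow n x).

Lemma aring_pow_family : is_power_family aring_pow.
Proof.
have [PX P0 PD] := totpowP gT.
have Sum n (I : Type) (s : seq I) (F : I -> aring n) :
    gsval (\sum_(i <- s) F i) = \sum_(i <- s) gsval (F i).
  by elim: s => [|i s IH]; rewrite ?big_nil // !big_cons -IH.
split=> [a|n n0|n a b]; apply: gsval_inj; first exact: P0.
  rewrite /= -bcls0 PX; apply/bclsP_iso/giso_sym.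
  apply: (@giso_inj_surj _ (gempty _) (gpow n (gempty gT))
    (fun u : void => match u with end)); [by case| |by []].
  by move=> y; case: n n0 y => // n _ y; case: (y ord0).
by rewrite Sum /= PD.
Qed.

End Aring.

Arguments aring_pow {gT} n x.
Arguments univ_pow {A} n a.

(* Main.v *)
From HB Require Import structures.
Require Import Defs.
From mathcomp Require Import all_boot all_order all_fingroup all_algebra.
From mathcomp Require Import boolp classical_sets.

(** Fix a finite G-set Z. The wreath product moves the coordinates of a point
x of Z^n independently within their G-orbits and permutes them, so the orbit
of x is determined by the numbers m_O of coordinates lying in the various
G-orbits O of Z, and it is isomorphic to the transfer product of the powers
O^(m_O) ([orb_merge], [monomial_totpow]). Put

      monomial x := the product over the orbits O of Z of P_(m_O)([O]),

for an arbitrary family P of power operations. For the universal family these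
elements span Pow(A(G)) additively: they are closed under products, since
juxtaposing points of X^i and Y^j gives a point of (X + Y)^(i+j) whose
monomial is the product ([monomial_merge]), and every P_n([X]) is reached by
cutting X into orbits ([monomials_span]). For the total power operations the
monomial of x is the class of the orbit of x. So the comparison map carries
the spanning set of monomials onto the set of classes of orbits of powers of
G-sets, which is the canonical basis of the target; this gives surjectivity.

Injectivity amounts to the converse statement that isomorphic orbits come
from equal monomials ([monomial_orb_iso]). It holds because the monomial can
be read off the stabiliser of x in the wreath product: i and j are carried
into one another by an element fixing x exactly when x_i and x_j lie in the
same G-orbit, and the elements concentrated in coordinate i that fix x form
the stabiliser of x_i, hence determine the orbit of x_i up to isomorphism
([monomial_stab]). Non-isomorphic transitive sets being linearly independent
in the Burnside ring, no relation between monomials can appear in the image.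
*)

Set Implicit Arguments.
Unset Strict Implicit.
Unset Printing Implicit Defensive.

Import GRing.Theory.
Local Open Scope ring_scope.

(** * The ring of series with homogeneous coefficients *)

Section Series.
Variable R : cgring.

Lemma gconvAf : associative (@gconv R).
Proof. by move=> p q r; apply: functional_extensionality_dep => n; apply: gconvA. Qed.

Lemma gconvCf : commutative (@gconv R).
Proof. by move=> p q; apply: functional_extensionality_dep => n; apply: gconvC. Qed.

Lemma gunit_convf : left_id (@gunit R) (@gconv R).
Proof. by move=> p; apply: functional_extensionality_dep => n; apply: gunit_conv. Qed.

(** Products of elements of varying degrees are taken in the ring of all series
    (v_n) with v_n in R_n, under convolution. No degree then has to be computed to
    form a big product, and the reindexing lemmas for big operators apply. *)
HB.instance Definition _ :=
  Monoid.isComLaw.Build (forall n, R n) (@gunit R) (@gconv R)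
    gconvAf gconvCf gunit_convf.

(** The series with the single term v. Multiplying by the unit, through the
    product that vanishes in the wrong degree, moves v from R_i to R_n without a
    transport. *)
Definition homog i (v : R i) : forall n, R n := fun n => gmulx n v (gone R).

Lemma homogE i (v : R i) : homog v i = v.
Proof.
have e : (i + 0 = i)%N by rewrite addn0.
by rewrite /homog (gmulxE e) (gmulC e (add0n i)) g1mul.
Qed.

Lemma homog_out i (v : R i) n : n <> i -> homog v n = 0.
Proof. by move=> ni; apply: gmulx_out; rewrite addn0 => /esym. Qed.

Lemma homog_one : homog (gone R) = @gunit R.
Proof.
apply: functional_extensionality_dep => -[|n]; first exact: homogE.
exact: homog_out.
Qed.

Lemma homogM i j n (e : (i + j = n)%N) (v : R i) (w : R j) :
  gconv (homog v) (homog w) = homog (gmul e v w).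
Proof.
apply: functional_extensionality_dep => m.
pose N := (m + i + j).+1.
have iN : (i < N)%N by rewrite ltnS addnAC leq_addl.
have jN : (j < N)%N by rewrite ltnS leq_addl.
have mN : (m < N)%N by rewrite ltnS -addnA leq_addr.
rewrite (gconvE _ _ mN) (bigD1 (Ordinal iN)) //= [X in _ + X]big1 ?addr0; last first.
  move=> a /eqP ai; rewrite big1 // => b _; rewrite homog_out ?gmul0x //.
  by move=> E; apply: ai; apply: val_inj.
rewrite (bigD1 (Ordinal jN)) //= big1 ?addr0; last first.
  move=> b /eqP bj; rewrite [homog w b]homog_out ?gmulx0 //.
  by move=> E; apply: bj; apply: val_inj.
rewrite !homogE; have [->|ne] := eqVneq m n; first by rewrite homogE gmulxE.
by rewrite homog_out ?gmulx_out // => E; case/eqP: ne; rewrite -E.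
Qed.

End Series.

Section SeriesMap.
Variables (R S : cgring) (f : forall n, R n -> S n).
Arguments f {n}.
Hypothesis fH : gr_hom (@f).

Definition series_map (p : forall n, R n) : forall n, S n := fun n => f (p n).

Let f0 n : f (0 : R n) = 0. Proof. by case: fH => fD _ _; apply: (morphD0 (fD n)). Qed.

Lemma series_map_unit : series_map (@gunit R) = @gunit S.
Proof. by apply: functional_extensionality_dep => -[|n]; [case: fH|apply: f0]. Qed.

Lemma series_map_conv p q : series_map (gconv p q) = gconv (series_map p) (series_map q).
Proof.
have [fD _ fM] := fH; apply: functional_extensionality_dep => n.
rewrite /series_map /gconv (big_morph _ (fD n) (f0 n)).
by apply: eq_bigr => i _; rewrite fM.
Qed.

Lemma series_map_hom i (v : R i) : series_map (homog v) = homog (f v).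
Proof.
have [_ f1 fM] := fH; apply: functional_extensionality_dep => n.
rewrite /series_map /homog /gmulx; case: eqP => [e|_]; last exact: f0.
by rewrite fM f1.
Qed.

End SeriesMap.

(** * Big operators over an image *)

Section BigImage.
Variables (V : Type) (idx : V) (op : Monoid.com_law idx).
Variables (I J J' : finType) (h : I -> J) (h' : I -> J') (F : J -> V) (F' : J' -> V).

(** Both big operators run over the classes of one equivalence relation on I,
    because h and h' have the same fibres; choose a transversal of it. *)
Lemma eq_big_image :
  (forall i j, (h i == h j) = (h' i == h' j)) -> (forall i, F (h i) = F' (h' i)) ->
  \big[op/idx]_(O in [set h i | i : I]) F O =
  \big[op/idx]_(O in [set h' i | i : I]) F' O.
Proof.
move=> hh FF.
pose r i := odflt i [pick j | h j == h i].
have hr i : h (r i) = h i by rewrite /r; case: pickP => [j /eqP|].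
have rr i j : h i = h j -> r i = r j.
  move=> E; rewrite /r E; case: pickP => // /(_ j); by rewrite eqxx.
pose D := [set r i | i : I].
have img (K : finType) (k : I -> K) : (forall i, k (r i) = k i) ->
    [set k i | i : I] = [set k i | i in D].
  move=> kr; apply/finset.setP => O; apply/imsetP/imsetP => -[i _ ->].
    by exists (r i); [apply: imset_f|rewrite kr].
  by exists i.
have h'r i : h' (r i) = h' i by apply/eqP; rewrite -hh hr.
have h'rr i j : h' i = h' j -> r i = r j.
  by move/eqP; rewrite -hh => /eqP; apply: rr.
have inj (K : finType) (k : I -> K) : (forall i, k (r i) = k i) ->
    (forall i j, k i = k j -> r i = r j) -> {in D &, injective k}.
  by move=> kr krr _ _ /imsetP[i _ ->] /imsetP[j _ ->]; rewrite !kr; apply: krr.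
rewrite (img _ h hr) (img _ h' h'r) (big_imset _ (inj _ h hr rr)).
by rewrite (big_imset _ (inj _ h' h'r h'rr)); apply: eq_bigr => i _; apply: FF.
Qed.

End BigImage.

(** * Orbits of G-sets *)

Section Orbits.
Variable gT : finGroupType.
Implicit Types W X Y Z : gset gT.

(** Both G-sets are the set of cosets of the common stabiliser. *)
Lemma giso_of_stab X Y (x : X) (y : Y) :
  (forall u, exists a, lact a x = u) -> (forall v, exists a, lact a y = v) ->
  (forall a, lact a x = x <-> lact a y = y) -> giso X Y.
Proof.
move=> xX yY st.
have st2 a b : lact a x = lact b x <-> lact a y = lact b y.
  have tr (Z : gset gT) (z : Z) : lact a z = lact b z <-> lact (b^-1 * a)%g z = z.
    by rewrite lactM; split=> [->|{2}<-]; rewrite ?lactK ?lactVK.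
  by rewrite !tr; apply: st.
pose s u := projT1 (cid (xX u)).
have sE u : lact (s u) x = u by rewrite /s; case: cid.
pose F u := lact (s u) y.
have FE a : F (lact a x) = lact a y by apply/st2; rewrite sE.
apply: (@giso_inj_surj _ _ _ F) => [u v /st2|v|a u]; first by rewrite !sE.
  by have [a <-] := yY v; exists (lact a x).
by rewrite -{1}(sE u) -lactM FE lactM.
Qed.

Definition orb W (w : W) : {set W} := [set lact a w | a : gT].

Lemma orbP W (w u : W) : reflect (exists a, lact a w = u) (u \in orb w).
Proof. by apply: (iffP imsetP) => [[a _ ->]|[a <-]]; exists a. Qed.

Lemma orb_refl W (w : W) : w \in orb w.
Proof. by apply/orbP; exists 1%g; rewrite lact1. Qed.

Lemma orb_lact W (w u : W) a : (lact a u \in orb w) = (u \in orb w).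
Proof.
apply/orbP/orbP => -[b E]; last by exists (a * b)%g; rewrite lactM E.
by exists (a^-1 * b)%g; rewrite lactM E lactK.
Qed.

Lemma orb_eq W (w u : W) : (orb w == orb u) = (w \in orb u).
Proof.
apply/eqP/idP => [<-|/orbP[a <-]]; first exact: orb_refl.
apply/finset.setP => v; apply/orbP/orbP => -[b <-].
  by exists (b * a)%g; rewrite lactM.
by exists (b * a^-1)%g; rewrite lactM lactK.
Qed.

(** The elements that never leave O: the largest invariant part of O. Being
    invariant for every O, it makes a G-set out of any element of [{set W}], so
    that big operators can run over the finite type of subsets of W; for an orbit
    O it is O itself. *)
Definition in_core W (O : {set W}) : pred W := fun w => [forall a, lact a w \in O].

Lemma in_core_invariant W (O : {set W}) : invariant_pred (in_core O).
Proof.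
move=> a w /forallP wO; apply/forallP => b; rewrite -lactM; exact: wO.
Qed.

Definition gcore W (O : {set W}) : gset gT := gsub (@in_core_invariant W O).

Lemma in_core_orb W (w u : W) : in_core (orb w) u = (u \in orb w).
Proof.
apply/forallP/idP => [/(_ 1%g)|uw a]; first by rewrite lact1.
by rewrite orb_lact.
Qed.

Lemma in_core_orbC W (w u : W) : in_core (~: orb w) u = (u \notin orb w).
Proof.
apply/forallP/idP => [/(_ 1%g)|uw a]; first by rewrite lact1 inE.
by rewrite inE orb_lact.
Qed.

Definition orb_base W (w : W) : gcore (orb w) :=
  exist _ w (etrans (in_core_orb w w) (orb_refl w)).

Lemma orb_base_gen W (w : W) (u : gcore (orb w)) : exists a, lact a (orb_base w) = u.
Proof.
case: u => u wu; have := wu; rewrite in_core_orb => /orbP[a E].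
by exists a; apply: val_inj.
Qed.

Lemma orb_base_stab W (w : W) a : lact a (orb_base w) = orb_base w <-> lact a w = w.
Proof. by split=> [/(congr1 val)|E]; last apply: val_inj. Qed.

Lemma gcore_orb_trans W (w : W) : gtransitive (gcore (orb w)).
Proof.
split=> [|u v]; first by exists (orb_base w).
have [a <-] := orb_base_gen u; have [b <-] := orb_base_gen v.
by exists (b * a^-1)%g; rewrite lactM lactK.
Qed.

Lemma gcore_orb_iso X Y (x : X) (y : Y) :
  (forall a, lact a x = x <-> lact a y = y) -> giso (gcore (orb x)) (gcore (orb y)).
Proof.
move=> st; apply: (giso_of_stab (@orb_base_gen _ x) (@orb_base_gen _ y)) => a.
rewrite !orb_base_stab; exact: st.
Qed.

Lemma gtransitive_orb X (x : X) : gtransitive X -> giso (gcore (orb x)) X.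
Proof.
case=> _ Xt; apply: gsubT => u; rewrite in_core_orb; apply/orbP; exact: Xt.
Qed.

(** Induction on the number of elements, splitting off one orbit. *)
Lemma gset_orbit_ind (K : gset gT -> Prop) :
  (forall X Y, giso X Y -> K X -> K Y) -> K (gempty gT) ->
  (forall X Y, gtransitive X -> K Y -> K (gsum X Y)) -> forall X, K X.
Proof.
move=> Kiso K0 Ksum X; have [m] := ubnP #|X|; elim: m X => // m IH X Xm.
have [[x _]|no] := pselect (exists x : X, True); last first.
  apply: Kiso K0; apply: (@giso_inj_surj _ (gempty gT) X
    (fun u : void => match u with end)); [by case| |by []].
  by move=> x; case: no; exists x.
have AI : invariant_pred (fun _ : X => true) by [].
apply: (Kiso (gsum (gcore (orb x)) (gcore (~: orb x)))).
  apply: giso_trans (gsubT AI _) => //.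
  apply: gsub_split => u; rewrite in_core_orb in_core_orbC ?orbN //.
  by move=> uO /negP.
apply: Ksum; first exact: gcore_orb_trans.
apply: IH; rewrite -ltnS; apply: leq_trans Xm; rewrite ltnS card_sig.
apply/proper_card/properP; split; first exact/fintype.subsetP.
by exists x => //; rewrite inE in_core_orbC orb_refl.
Qed.

End Orbits.

(** * Points of powers of G-sets *)

Section Powers.
Variable gT : finGroupType.
Implicit Types X Y Z : gset gT.

(** If g x_i = x_j, transposing i and j while acting by g and its inverse on
    these two coordinates fixes x. *)
Lemma gpow_orbP n Z (x : gpow n Z) (i j : 'I_n) :
  (x j \in orb (x i)) <-> exists a : wreath gT n, lact a x = x /\ wperm a i = j.
Proof.
split=> [/orbP[g gx]|[a [ax <-]]]; last first.
  apply/orbP; exists (wtup a (wperm a i)).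
  by rewrite -{2}ax ffunE permK.
have [<-|ij] := eqVneq i j; first by exists 1%g; rewrite lact1 perm1.
exists (Wreath [ffun k => if k == j then g else if k == i then g^-1%g else 1%g]
  (tperm i j)); split; last by rewrite /= tpermL.
apply/ffunP => k; rewrite !ffunE /= tpermV.
case: (tpermP i j k) => [->|->|]; first by rewrite (negbTE ij) eqxx -gx lactK.
  by rewrite eqxx.
by move=> /eqP/negbTE -> /eqP/negbTE ->; rewrite lact1.
Qed.

(** The stabiliser of a coordinate is visible in the stabiliser of the point. *)
Lemma gpow_stabP n Z (x : gpow n Z) (i : 'I_n) g :
  lact g (x i) = x i <->
  lact (Wreath [ffun k => if k == i then g else 1%g] 1%g : wreath gT n) x = x.
Proof.
split=> [E|/(congr1 (fun w : {ffun _ -> _} => w i))]; last first.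
  by rewrite !ffunE /= eqxx invg1 perm1.
apply/ffunP => k; rewrite !ffunE /= invg1 perm1.
by case: eqP => [->|_]; rewrite ?E ?lact1.
Qed.

Lemma gpow_trans n Z (x y : gpow n Z) :
  (forall i, y i \in orb (x i)) -> exists a, lact a x = y.
Proof.
move=> H; have H' i : exists g, lact g (x i) = y i by apply/orbP.
exists (Wreath [ffun i => projT1 (cid (H' i))] 1%g); apply/ffunP => i.
by rewrite !ffunE /= invg1 perm1; case: cid.
Qed.

(** Elements of the wreath product that carry one juxtaposed point to another lie
    in the block subgroup ([gmerge_fibre]), because they cannot mix the coordinates
    in X with those in Y; so the orbit is induced from the block subgroup. *)
Lemma orb_merge i j n (e : (i + j = n)%N) X Y (x : gpow i X) (y : gpow j Y) :
  giso (transfer e (gcore (orb x)) (gcore (orb y)))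
       (gcore (orb (gmerge e ((x, y) : gxprod (gpow i X) (gpow j Y))))).
Proof.
set m := gmerge e _.
pose lift (u : gcore (orb x)) (v : gcore (orb y)) :
  gpow n (gsum X Y) := gmerge e ((sval u, sval v) : gxprod (gpow i X) (gpow j Y)).
have lP u v : in_core (orb m) (lift u v).
  have [a <-] := orb_base_gen u; have [b <-] := orb_base_gen v.
  rewrite in_core_orb; apply/orbP; exists (wembed e (a, b)).
  exact: (esym (gmerge_lact e (a, b) (x, y))).
apply: (@transfer_isoP _ _ _ _ e _ _ _
  (fun z => exist _ (lift z.1 z.2) (lP z.1 z.2) : gcore (orb m))).
split=> [h z|w|c [u v] [u' v'] /(congr1 val) /=].
- by apply: val_inj; exact: (gmerge_lact e h (sval z.1, sval z.2)).
- have [c <-] := orb_base_gen w; exists c, (orb_base x, orb_base y).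
  by congr lact; apply: val_inj.
- move=> /gmerge_fibre[h [-> [E1 E2]]]; exists h; split=> //.
  by congr pair; apply: val_inj.
Qed.

End Powers.

(** * The monomial attached to a point *)

Section Monomial.
Variables (gT : finGroupType) (R : cgring) (P : forall n, burnside gT -> R n).
Hypothesis PP : is_power_family P.
Implicit Types X Y Z : gset gT.

Definition orbits Z : {set {set Z}} := [set orb z | z : Z].

Definition monomial_factor n Z (x : gpow n Z) (O : {set Z}) : forall m, R m :=
  homog (P #|[set i | x i \in O]| (bcls (gcore O))).

(** Orbits O that x does not meet contribute P_0 = 1. Keeping them makes the
    invariance under the action and the multiplicativity immediate. *)
Definition monomial n Z (x : gpow n Z) : forall m, R m :=
  \big[@gconv R/@gunit R]_(O in orbits Z) monomial_factor x O.

Lemma homog_P m m' a a' : m = m' -> a = a' -> homog (P m a) = homog (P m' a').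
Proof. by move=> -> ->. Qed.

Lemma homog_P0 m a : m = 0%N -> homog (P m a) = @gunit R.
Proof. by move=> ->; case: PP => -> _ _; apply: homog_one. Qed.

Lemma monomial_lact n Z c (x : gpow n Z) : monomial (lact c x) = monomial x.
Proof.
apply: eq_bigr => _ /imsetP[z _ ->]; apply: homog_P => //.
rewrite -[RHS](card_imset _ (@perm_inj _ (wperm c))); congr #|pred_of_set _|.
apply/finset.setP => i; rewrite inE ffunE orb_lact; apply/idP/imsetP => [H|[j]].
  by exists ((wperm c)^-1%g i); rewrite ?inE ?permKV.
by rewrite inE => H ->; rewrite permK.
Qed.

(** Indexing by the orbits met by x makes the monomial independent of the part
    of Z that x does not see. *)
Lemma monomial_occupied n Z (x : gpow n Z) :
  monomial x = \big[@gconv R/@gunit R]_(O in [set orb (x i) | i : 'I_n]) monomial_factor x O.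
Proof.
rewrite /monomial big_mkcond [RHS]big_mkcond /=; apply: eq_bigr => O _.
case: ifP => [/imsetP[z _ ->]|nO]; case: ifP => //.
  move=> no; apply: homog_P0; apply: eq_card0 => i; rewrite inE.
  apply/negP => xi; case/negP: no; apply/imsetP; exists i => //.
  by apply/eqP; rewrite eq_sym orb_eq.
by case/imsetP=> i _ OE; rewrite OE imset_f in nO.
Qed.

(** By [gpow_orbP] the stabiliser of x tells which coordinates share an orbit,
    and by [gpow_stabP] which orbit it is up to isomorphism. So
    the monomial depends on the stabiliser alone, not on the way the orbit of x is
    embedded in a power. *)
Lemma monomial_stab n Z Z' (x : gpow n Z) (x' : gpow n Z') :
  (forall a, lact a x = x <-> lact a x' = x') -> monomial x = monomial x'.
Proof.
move=> st; rewrite !monomial_occupied.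
have same i j : (x j \in orb (x i)) = (x' j \in orb (x' i)).
  by apply/idP/idP => /gpow_orbP[a [/st ax ai]]; apply/gpow_orbP; exists a.
apply: eq_big_image => [i j|i]; first by rewrite !orb_eq same.
apply: homog_P; first by congr #|pred_of_set _|; apply/finset.setP => j; rewrite !inE same.
apply/bclsP_iso/gcore_orb_iso => g; rewrite !gpow_stabP; exact: st.
Qed.

(** The orbits of a disjoint union are the orbits of both parts, and the
    coordinates of the juxtaposed point in an orbit of X are those of x. *)
Lemma monomial_merge i j n (e : (i + j = n)%N) X Y (x : gpow i X) (y : gpow j Y) :
  monomial (gmerge e ((x, y) : gxprod (gpow i X) (gpow j Y))) = gconv (monomial x) (monomial y).
Proof.
set z := gmerge e _.
pose L (O : {set X}) : {set gsum X Y} := [set inl u | u in O].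
pose M (O : {set Y}) : {set gsum X Y} := [set inr u | u in O].
have inlE O u : ((inl u : gsum X Y) \in L O) = (u \in O).
  by apply: mem_imset => ? ? [].
have inrE O u : ((inr u : gsum X Y) \in M O) = (u \in O).
  by apply: mem_imset => ? ? [].
have inlF O u : ((inl u : gsum X Y) \in M O) = false.
  by apply/negP => /imsetP[].
have inrF O u : ((inr u : gsum X Y) \in L O) = false.
  by apply/negP => /imsetP[].
have Lorb u : orb (inl u : gsum X Y) = L (orb u).
  by apply/finset.setP => v; apply/orbP/imsetP => [[a <-]|[v' /orbP[a <-] ->]];
    [exists (lact a u) => //; apply/orbP|]; exists a.
have Morb u : orb (inr u : gsum X Y) = M (orb u).
  by apply/finset.setP => v; apply/orbP/imsetP => [[a <-]|[v' /orbP[a <-] ->]];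
    [exists (lact a u) => //; apply/orbP|]; exists a.
have Linj : injective L by apply: imset_inj => ? ? [].
have Minj : injective M by apply: imset_inj => ? ? [].
have E : orbits (gsum X Y) = (L @: orbits X) :|: (M @: orbits Y).
  apply/finset.setP => O; rewrite inE; apply/imsetP/orP => [[[u|u] _ ->]|].
  - by left; rewrite Lorb; do 2 apply: imset_f.
  - by right; rewrite Morb; do 2 apply: imset_f.
  - case=> /imsetP[_ /imsetP[u _ ->] ->]; first by exists (inl u).
    by exists (inr u).
rewrite /monomial E (eq_bigl _ _ (fun O => finset.in_setU O _ _)) bigU /=; last first.
  rewrite disjoint_subset; apply/fintype.subsetP => _ /imsetP[_ /imsetP[u _ ->] ->].
  rewrite inE; apply/negP.
  case/imsetP=> O' _ /finset.setP/(_ (inl u)).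
  by rewrite inlE inlF orb_refl.
have zL O : #|[set k | z k \in L O]| = #|[set a | x a \in O]|.
  rewrite -[RHS](card_imset (f := fun a => blk e (inl a))); last first.
    by move=> a b /(can_inj (blkK e)) [].
  congr #|pred_of_set _|; apply/finset.setP; apply: (blkP (e := e)) => u.
  rewrite inE gmergeE; apply/idP/imsetP => [|[a]].
    by case: u => a; rewrite ?inrF // inlE => H; exists a; rewrite // inE.
  by rewrite inE => H /(can_inj (blkK e)) ->; rewrite inlE.
have zM O : #|[set k | z k \in M O]| = #|[set a | y a \in O]|.
  rewrite -[RHS](card_imset (f := fun a => blk e (inr a))); last first.
    by move=> a b /(can_inj (blkK e)) [].
  congr #|pred_of_set _|; apply/finset.setP; apply: (blkP (e := e)) => u.
  rewrite inE gmergeE; apply/idP/imsetP => [|[a]].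
    by case: u => a; rewrite ?inlF // inrE => H; exists a; rewrite // inE.
  by rewrite inE => H /(can_inj (blkK e)) ->; rewrite inrE.
rewrite (big_imset _ (in2W Linj)) (big_imset _ (in2W Minj)) /=.
congr gconv; apply: eq_bigr => _ /imsetP[u _ ->]; apply: homog_P => //.
  by rewrite -Lorb; apply/bclsP_iso/gcore_orb_iso => a; split=> [[]|H] //=; rewrite H.
by rewrite -Morb; apply/bclsP_iso/gcore_orb_iso => a; split=> [[]|H] //=; rewrite H.
Qed.

Lemma monomial_trans n Z (x : gpow n Z) : gtransitive Z -> monomial x = homog (P n (bcls Z)).
Proof.
move=> Zt; have [[z _] Ztr] := Zt.
have orbT u : orb u = [set: Z].
  by apply/finset.setP => v; rewrite inE; apply/orbP; apply: Ztr.
have -> : monomial x = monomial_factor x [set: Z].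
  rewrite /monomial (_ : orbits Z = [set [set: Z]]) ?big_set1 //.
  apply/finset.setP => O; rewrite inE; apply/imsetP/eqP => [[u _ ->]//|->].
  by exists z; rewrite ?orbT.
apply: homog_P.
  by rewrite -[RHS]card_ord -cardsT; congr #|pred_of_set _|; apply/finset.setP => i; rewrite !inE.
by rewrite -(orbT z); apply/bclsP_iso/gtransitive_orb.
Qed.

End Monomial.

(** * Spans and separating functionals *)

Section SpanTheory.

Lemma morphB_morphD (V W : zmodType) (f : V -> W) :
  {morph f : x y / x - y} -> {morph f : x y / x + y}.
Proof.
move=> fB; have f0 : f 0 = 0 by have := fB 0 0; rewrite !subrr.
by move=> x y; rewrite -[y in LHS]opprK fB -[- y]sub0r fB f0 sub0r opprK.
Qed.

Lemma zspan_bilinear (U V W : zmodType) (m : U -> V -> W)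
    (S : set U) (T : set V) (Q : set W) :
  (forall v, {morph m^~ v : u u' / u + u'}) -> (forall u, {morph m u : v v' / v + v'}) ->
  (forall u v, S u -> T v -> zspan Q (m u v)) ->
  forall u v, zspan S u -> zspan T v -> zspan Q (m u v).
Proof.
move=> mDl mDr mQ u v Su Tv.
have H u' : S u' -> (zspan T `<=` [set v | zspan Q (m u' v)])%classic.
  move=> Su'; apply: zspan_min => [|v' Tv']; last exact: mQ.
  split=> [|v1 v2 H1 H2] /=; first by rewrite (morphD0 (mDr u')); apply: zspan0.
  by rewrite (morphDB (mDr u')); apply: zspanB.
suff H' : (zspan S `<=` [set u | zspan Q (m u v)])%classic by apply: H'.
apply: zspan_min => [|u' Su']; last exact: (H u').
split=> [|u1 u2 H1 H2] /=; first by rewrite (morphD0 (mDl v)); apply: zspan0.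
by rewrite (morphDB (mDl v)); apply: zspanB.
Qed.

Lemma zspan_combination (V : zmodType) (S : set V) x : zspan S x ->
  exists2 s : seq (V * int), (forall p, p \in s -> S p.1) & x = \sum_(p <- s) p.1 *~ p.2.
Proof.
apply: (zspan_min (T := [set x | exists2 s : seq (V * int),
  (forall p, p \in s -> S p.1) & x = \sum_(p <- s) p.1 *~ p.2]%classic)) => [|b Sb] /=.
  split=> [|_ _ [s sS ->] [t tS ->]] /=; first by exists [::]; rewrite ?big_nil.
  exists (s ++ [seq (p.1, - p.2) | p <- t]) => [p|].
    by rewrite mem_cat => /orP[/sS //|/mapP[q /tS qS ->]].
  rewrite big_cat big_map /= -sumrN; congr (_ + _).
  by apply: eq_bigr => p _; rewrite mulrNz.
exists [:: (b, 1)] => [p|]; first by rewrite inE => /eqP ->.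
by rewrite big_seq1 mulr1z.
Qed.

(** Linear independence by separation: for each b in S there is a functional on
    the target detecting the image of b and of no other element of S. The integer
    coefficients of b in a relation then sum to zero, and b can be removed from
    the relation. *)
Lemma zspan_kernel (V W : zmodType) (f : V -> W) (S : set V) :
  {morph f : x y / x + y} ->
  (forall b, S b -> exists d : W -> int, [/\ {morph d : x y / x + y},
     d (f b) != 0 & forall b', S b' -> d (f b') != 0 -> b' = b]) ->
  forall x, zspan S x -> f x = 0 -> x = 0.
Proof.
move=> fD sep _ /zspan_combination[s sS ->].
have [m] := ubnP (size s); elim: m s sS => // m IH [|p s] sS; first by rewrite big_nil.
move=> sm fs; have pS := sS p (mem_head _ _).
have [d [dD dp d_sep]] := sep _ pS.
pose g := d \o f; have gD : {morph g : x y / x + y} by move=> x y; rewrite /g /= fD dD.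
have gZ x c : g (x *~ c) = g x * c.
  elim/int_rec: c => [|n IHn|n IHn]; first by rewrite mulr0z (morphD0 gD) mulr0.
    by rewrite intS mulrzDr gD IHn mulr1z mulrDr mulr1.
  by rewrite intS opprD mulrzDr gD IHn mulrN1z (morphDN gD) mulrDr mulrN1.
pose c := \sum_(q <- p :: s | q.1 == p.1) q.2.
have c0 : c = 0.
  have : g p.1 * c = 0.
    rewrite -[RHS](morphD0 dD) -fs [d _](big_morph g gD (morphD0 gD)).
    rewrite /c mulr_sumr [LHS]big_mkcond big_seq [RHS]big_seq.
    apply: eq_bigr => q /sS qS; rewrite gZ; case: eqP => [->//|qp].
    have [->|/(d_sep _ qS) //] := eqVneq (g q.1) 0; by rewrite mul0r.
  by move/eqP; rewrite mulf_eq0 (negbTE dp) => /eqP.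
have E : \sum_(q <- p :: s) q.1 *~ q.2 =
    \sum_(q <- [seq q <- p :: s | q.1 != p.1]) q.1 *~ q.2.
  rewrite big_filter (bigID (fun q => q.1 == p.1)) /=.
  rewrite (eq_bigr (fun q => p.1 *~ q.2)) => [|q /eqP -> //].
  by rewrite -mulrz_sumr -/c c0 mulr0z add0r.
rewrite E; apply: IH; last by rewrite -E.
  by move=> q; rewrite mem_filter => /andP[_ /sS].
rewrite /= eqxx /=; rewrite ltnS /= in sm; apply: leq_trans sm.
by rewrite ltnS size_filter count_size.
Qed.

End SpanTheory.

(** * Induction on points of powers *)

Section PointInduction.
Variable gT : finGroupType.
Implicit Types X Y Z : gset gT.

Lemma gpow_map_stab n X Y (f : X -> Y) (x : gpow n X) (y : gpow n Y) :
  injective f -> equivariant f -> (forall i, y i = f (x i)) ->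
  forall a, lact a x = x <-> lact a y = y.
Proof.
move=> fi fE yE a.
have E i : (lact a y : gpow n Y) i = f ((lact a x : gpow n X) i).
  by rewrite !ffunE yE fE.
split=> ax; apply/ffunP => i; first by rewrite E ax yE.
by apply: fi; rewrite -E -yE ax.
Qed.

(** The orbits of the base are split off one at a time: up to the action, a point
    of (X + Y)^n is the juxtaposition of a point of X^i and one of Y^(n-i), with X a
    single orbit. The first hypothesis lets the base be replaced by an isomorphic
    one. *)
Lemma gpow_point_ind (K : forall n Z, gpow n Z -> Prop) :
  (forall n Z Z' (x : gpow n Z) (x' : gpow n Z'),
    (forall a, lact a x = x <-> lact a x' = x') -> K n Z x -> K n Z' x') ->
  (forall n Z c (x : gpow n Z), K n Z x -> K n Z (lact c x)) ->
  (forall x : gpow 0 (gempty gT), K 0%N (gempty gT) x) ->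
  (forall n Z (x : gpow n Z), gtransitive Z -> K n Z x) ->
  (forall i j n (e : (i + j = n)%N) X Y (x : gpow i X) (y : gpow j Y),
    K i X x -> K j Y y ->
    K n (gsum X Y) (gmerge e ((x, y) : gxprod (gpow i X) (gpow j Y)))) ->
  forall n Z (x : gpow n Z), K n Z x.
Proof.
move=> Kstab Klact K0 Ktrans Kmerge n Z; elim/gset_orbit_ind: Z n.
- move=> X Y [f [[g fK gK] fE]] IH n y.
  apply: (Kstab _ _ _ ([ffun i => g (y i)] : gpow n X)) (IH _ _).
  by apply: (gpow_map_stab (can_inj fK) fE) => i; rewrite ffunE gK.
- by case=> [|n] x; [apply: K0|case: (x ord0)].
- move=> X Y Xt IH n w.
  have wn : (nleft w <= n)%N.
    rewrite -[X in (_ <= X)%N]card_ord -sum1_card.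
    by apply: leq_sum => m _; apply: leq_b1.
  have [c [[x y] ->]] := gmerge_surj (subnKC wn) erefl.
  apply: Klact; apply: Kmerge; [exact: Ktrans|exact: IH].
Qed.

End PointInduction.

(** * Monomials for a family of power operations *)

Section PowerFamily.
Variables (gT : finGroupType) (R : cgring) (P : forall n, burnside gT -> R n).
Hypothesis PP : is_power_family P.

(** A family of power operations is a homomorphism into the group of series with
    constant term 1, so it respects differences. *)
Lemma power_family_sub n x y : P n (x - y) = gconv (P^~ x) (ginv (P^~ y)) n.
Proof.
have [P0 _ PD] := PP.
pose s x := GSeries (P0 x : (P^~ x) 0%N = gone R).
have sD : {morph s : x y / x + y} by move=> x' y'; apply: gserP => m; apply: PD.
exact: (congr1 (fun p => gser p n) (morphDB sD x y)).
Qed.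

Lemma monomial_empty (x : gpow 0 (gempty gT)) : monomial P x = @gunit R.
Proof. by rewrite /monomial big_pred0 // => O; apply/negbTE/negP => /imsetP[[]]. Qed.

(** The degrees of the factors add up to the number of coordinates. *)
Lemma monomial_homog n (Z : gset gT) (x : gpow n Z) : monomial P x = homog (monomial P x n).
Proof.
suff [v ->] : exists v : R n, monomial P x = homog v by rewrite homogE.
elim/gpow_point_ind: n Z / x => [n Z Z' x x' st [v E]|n Z c x [v E]|x|n Z x Zt|].
- by exists v; rewrite -(monomial_stab PP st).
- by exists v; rewrite monomial_lact.
- by exists (gone R); rewrite monomial_empty homog_one.
- by exists (P n (bcls Z)); apply: monomial_trans.
- move=> i j n e X Y x y [v Ev] [w Ew]; exists (gmul e v w).
  by rewrite monomial_merge Ev Ew; apply: homogM.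
Qed.

(** An isomorphism carries x to a point of the orbit of x' with the same
    stabiliser as x. *)
Lemma monomial_orb_iso n (Z Z' : gset gT) (x : gpow n Z) (x' : gpow n Z') :
  giso (gcore (orb x)) (gcore (orb x')) -> monomial P x = monomial P x'.
Proof.
case=> f [[g fK _] fE]; have [c cE] := orb_base_gen (f (orb_base x)).
rewrite -(monomial_lact P c x'); apply: (monomial_stab PP) => a.
have -> : lact c x' = sval (f (orb_base x)) by rewrite -cE.
rewrite -(orb_base_stab x); split=> [E|E]; first by rewrite -{2}E fE.
by apply: (can_inj fK); rewrite fE; apply: val_inj.
Qed.

End PowerFamily.

(** * The comparison map *)

Section Main.
Variable gT : finGroupType.
Notation PowA := (Pow (burnside gT)).
Notation U := (@univ_pow (burnside gT)).
Notation BW := (burnside_wreath gT).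
Notation T := (@totpow gT : forall n, burnside gT -> BW n).

Lemma totpow_family : is_power_family T.
Proof.
have [P0 Pn0 PD] := aring_pow_family gT; have [_ TP0 TPD] := totpowP gT.
split=> // n n0; exact: (congr1 (@gsval _ _ _) (Pn0 n n0)).
Qed.

(** Induction on points: if Z is a single orbit then so is Z^n, and transfer
    products of orbits correspond to juxtaposition. *)
Lemma monomial_totpow n (Z : gset gT) (x : gpow n Z) :
  monomial T x = homog (bcls (gcore (orb x)) : BW n).
Proof.
have [TX _ _] := totpowP gT.
elim/gpow_point_ind: n Z / x => [n Z Z' x x' st E|n Z c x E|x|n Z x Zt|].
- rewrite -(monomial_stab totpow_family st) E; congr homog.
  exact/bclsP_iso/gcore_orb_iso.
- rewrite monomial_lact E; congr homog; congr bcls; congr gcore.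
  by apply/eqP; rewrite eq_sym orb_eq orb_lact orb_refl.
- rewrite monomial_empty -homog_one; congr homog; apply/bclsP_iso.
  apply: (@giso_of_stab _ (gpoint _) _ tt _ _ (@orb_base_gen _ _ x)).
    by case; exists 1%g.
  by move=> a; split=> // _; apply/orb_base_stab/ffunP => -[].
- rewrite monomial_trans // TX; congr homog; apply/bclsP_iso/giso_sym/gtransitive_orb.
  have [_ Zt'] := Zt.
  split=> [|y z]; first by exists x.
  by apply: gpow_trans => i; apply/orbP; apply: Zt'.
- move=> i j n e X Y x y Ex Ey; rewrite monomial_merge Ex Ey.
  rewrite (homogM e); congr homog.
  by rewrite [LHS]starE; apply/bclsP_iso/orb_merge.
Qed.

Definition monomials n : set (PowA n) :=
  [set v | exists Z (x : gpow n Z), v = monomial U x n]%classic.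

Lemma monomials_mul i j n (e : (i + j = n)%N) (v : PowA i) (w : PowA j) :
  zspan (@monomials i) v -> zspan (@monomials j) w -> zspan (@monomials n) (gmul e v w).
Proof.
apply: (zspan_bilinear (m := gmul e)) => {v w} [w v v'|v w w'|_ _ [X [x ->]] [Y [y ->]]].
- exact: gmulDl.
- exact: gmulDr.
apply: zspan_in; exists (gsum X Y), (gmerge e ((x, y) : gxprod (gpow i X) (gpow j Y))).
have UP := @univ_powP (burnside gT).
by rewrite monomial_merge (monomial_homog UP x) (monomial_homog UP y) (homogM e) !homogE.
Qed.

Lemma monomials_one : zspan (@monomials 0) (gone PowA).
Proof.
apply: zspan_in; pose x : gpow 0 (gempty gT) := [ffun i : 'I_0 => match notF (ltn_ord i) with end].
by exists (gempty gT), x; rewrite monomial_empty.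
Qed.

Lemma monomials_gconv (p q : forall n, PowA n) n :
  (forall i, (i <= n)%N -> zspan (@monomials i) (p i)) ->
  (forall i, (i <= n)%N -> zspan (@monomials i) (q i)) ->
  zspan (@monomials n) (gconv p q n).
Proof.
move=> Sp Sq; apply: zspan_sum => i; apply: monomials_mul.
  by apply: Sp; rewrite -ltnS.
by apply: Sq; apply: leq_subr.
Qed.

Lemma monomials_ginv (p : forall n, PowA n) n :
  (forall n, zspan (@monomials n) (p n)) -> zspan (@monomials n) (ginv p n).
Proof.
move=> Sp; elim/ltn_ind: n => n IH; rewrite ginvE; apply: zspanB.
  by case: n {IH} => [|n]; [apply: monomials_one|apply: zspan0].
apply: zspan_sum => i; rewrite /gmulx; case: eqP => [e|_]; last exact: zspan0.
apply: monomials_mul; first exact: Sp.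
by apply: IH; rewrite ltn_subrL /=; apply: leq_trans (ltn_ord i).
Qed.

(** Additivity reduces the claim to transitive G-sets Z, where P_n([Z]) is the
    monomial of any point of Z^n. Differences need the inverse series, whose
    coefficients are polynomials in those of the original one. *)
Lemma monomials_univ n a : zspan (@monomials n) (U n a).
Proof.
have UP := @univ_powP (burnside gT); have [U0 Un0 UD] := UP.
elim/burnside_ind: a n => [X|x y Sx Sy] n; last first.
  by rewrite power_family_sub //; apply: monomials_gconv => // i _; apply: monomials_ginv.
elim/gset_orbit_ind: X n => [X Y XY SX n|n|X Y Xt SY n].
- by rewrite -(bclsP_iso XY).
- case: n => [|n]; first by rewrite U0; apply: monomials_one.
  by rewrite bcls0 Un0 //; apply: zspan0.
have SX m : zspan (@monomials m) (U m (bcls X)).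
  have [[z _] _] := Xt; apply: zspan_in.
  exists X, ([ffun=> z] : gpow m X); by rewrite monomial_trans // homogE.
by rewrite bclsD UD; apply: zspan_sum => i; apply: monomials_mul.
Qed.

Lemma monomials_span n (v : PowA n) : zspan (@monomials n) v.
Proof.
elim/pow_ind: v => t.
elim: n / t => [n a|n||n x IHx y IHy|n x IHx|i j n e x IHx y IHy].
- exact: monomials_univ.
- exact: zspan0.
- exact: monomials_one.
- by rewrite -powDE; apply: zspanD.
- have -> : pow_pi (pow_opp x) = 0 - pow_pi x :> PowA n by rewrite sub0r [RHS]powNE.
  by apply: zspanB => //; apply: zspan0.
- by rewrite -powME; apply: monomials_mul.
Qed.

Let F := pow_lift (@aring_pow gT).
Let FH : gr_hom F := pow_lift_hom (aring_pow_family gT).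

(** The comparison map carries the universal family to the total power operations,
    hence monomials to monomials. *)
Lemma aring_monomial n (Z : gset gT) (x : gpow n Z) :
  gsval (F (monomial U x n)) = bcls (gcore (orb x)).
Proof.
pose f n (v : PowA n) : BW n := gsval (F v).
have fH : gr_hom f.
  have [FD F1 FM] := FH; rewrite /f; split=> [m v w||i j m e v w].
  - by rewrite FD.
  - by rewrite F1.
  - by rewrite FM.
have E : series_map f (monomial U x) = monomial T x.
  rewrite /monomial (big_morph _ (series_map_conv fH) (series_map_unit fH)).
  apply: eq_bigr => O _; rewrite series_map_hom //; congr homog.
  by rewrite /f /F (pow_lift_univ (aring_pow_family gT)).
have := congr1 (fun p : forall n, BW n => p n) E.
by rewrite monomial_totpow homogE.
Qed.

(** Counting the points that lie in orbits isomorphic to that of x separates the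
    monomial of x from the other ones: the image of a monomial is the class of a
    single orbit, and a non-zero count makes this orbit isomorphic to that of x. *)
Lemma aring_inj n : injective (@F n).
Proof.
have [FD _ _] := FH.
have K (v : PowA n) : gsval (F v) = 0 -> v = 0.
  apply: (@zspan_kernel (PowA n) (BW n) (fun v => gsval (F v)) (@monomials n) _ _ v
    (monomials_span v)).
    by move=> v1 v2; rewrite FD.
  move=> _ [Z [x ->]]; have Ot := gcore_orb_trans x.
  exists (detect (gcore (orb x))); split=> [||_ [Z' [x' ->]]].
  - exact/morphB_morphD/detectB.
  - by rewrite aring_monomial; apply/detect_embeds/giso_embeds/giso_refl.
  rewrite aring_monomial => /(detect_trans Ot (gcore_orb_trans x')) xx'.
  by rewrite (monomial_orb_iso (@univ_powP _) xx').
move=> v w E; apply/eqP; rewrite -subr_eq0; apply/eqP/K.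
by rewrite (morphDB (FD n)) E subrr.
Qed.

(** A transitive set embedded in Z^n is the orbit of the image of any of its
    points. *)
Lemma aring_surj n (w : aring gT n) : exists v, F v = w.
Proof.
have [FD _ _] := FH.
suff H : (zspan (power_basis gT n) `<=`
    [set b : BW n | exists v : PowA n, gsval (F v) = b])%classic.
  by have [v E] := H _ (gsvalP w); exists v; apply: gsval_inj.
rewrite power_basisE; apply: zspan_min.
  split=> [|_ _ [v <-] [w' <-]] /=; first by exists 0; rewrite (morphD0 (FD n)).
  by exists (v - w'); rewrite (morphDB (FD n)).
move=> _ [W [Z [[[t _] Wt] [f [fi fE]] ->]]] /=.
exists (monomial U (f t) n); rewrite aring_monomial; apply/bclsP_iso/giso_sym.
apply: (giso_of_stab (Wt t) (@orb_base_gen _ _ (f t))) => a.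
rewrite orb_base_stab -fE; split=> [->//|]; exact: fi.
Qed.

End Main.

Theorem corollary6p7 (gT : finGroupType) :
  exists! f : forall n : nat, Pow (burnside gT) n -> aring gT n,
    gr_iso f /\
    forall (n : nat) (x : burnside gT), f n (univ_pow n x) = aring_pow n x.
Proof.
exists (pow_lift (@aring_pow gT)); split.
  split; last by move=> n x; apply: (pow_lift_univ (aring_pow_family gT)).
  split=> [|n]; first exact: (pow_lift_hom (aring_pow_family gT)).
  pose g (w : aring gT n) := projT1 (cid (aring_surj (n := n) w)).
  have gK : cancel g (@pow_lift _ _ (@aring_pow gT) n).
    by move=> w; rewrite /g; case: cid.
  by exists g => // v; apply: aring_inj; rewrite gK.
move=> f [[fH _] fU]; apply: functional_extensionality_dep => n.
apply: functional_extensionality_dep => x.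
by rewrite (pow_lift_unique (aring_pow_family gT) fH fU).
Qed.
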